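(* Let $\alpha>0$ and let $(X_t)_{t\in\mathbb{Z}}$ be a strictly stationary max-stable time series with $\alpha$-Fréchet margins and extremal coefficient function $\{\theta(h)\}_{h\in\mathbb{Z}}$ such that $h\mapsto\theta(h)$ is non-decreasing on $\mathbb{N}_0$. If there exist a sequence $\{u_n\}_{n\in\mathbb{N}}\subset\mathbb{R}$ of thresholds and an intermediate sequence $\{r_n\}_{n\in\mathbb{N}}\subset\mathbb{N}$ with $\lim_{n\to\infty}u_n=\lim_{n\to\infty}r_n=\infty$, $\lim_{n\to\infty}n\,\mathbb{P}(X_0>u_n)=\infty$, $\lim_{n\to\infty}r_n\,\mathbb{P}(X_0>u_n)=0$ such that $$\lim_{n\to\infty}u_n^{\alpha}\sum_{h=1}^\infty h^2\,(2-\theta(h+r_n))=0$$ and $$\lim_{k\to\infty}\limsup_{n\to\infty}\sum_{h=k}^{r_n}(2-\theta(h))=0,$$ then Condition (M) (see context) holds.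
   Context: The $\alpha$-Fréchet distribution is $\Phi_\alpha(x)=\exp(-x^{-\alpha})$, $x>0$. A stationary max-stable time series with $\alpha$-Fréchet margins can be represented as $$X_t=\bigvee_{j=1}^\infty\big(\Gamma_j^{-1}W_t^{(j)}\big)^{1/\alpha},\qquad t\in\mathbb{Z},$$ where $\{\Gamma_j\}_{j\in\mathbb{N}}$ are the arrival times of a unit rate Poisson process and, independently, $(W^{(j)}_t)_{t\in\mathbb{Z}}$, $j\in\mathbb{N}$, are independent copies of a nonnegative time series $(W_t)_{t\in\mathbb{Z}}$ with $\mathbb{E}W_t=1$ for all $t$. Its extremal coefficient function $\{\theta(h)\}_{h\in\mathbb{Z}}\subset[1,2]$ is given by $\mathbb{P}(X_h\le x,\,X_0\le x)=\mathbb{P}(X_0\le x)^{\theta(h)}$, $x>0$, $h\in\mathbb{Z}$. The $\alpha$-mixing coefficients are $$\alpha_h=\sup_{A,B\in\mathcal{B}(\mathbb{R}^{\mathbb{N}})}\big|\mathbb{P}((X_s)_{s\le0}\in A,\,(X_s)_{s\ge h}\in B)-\mathbb{P}((X_s)_{s\le0}\in A)\,\mathbb{P}((X_s)_{s\ge h}\in B)\big|,\quad h\ge0.$$ Condition (M): there exist a sequence $(u_n)_{n\in\mathbb{N}}\subset\mathbb{R}$ of thresholds and an intermediate sequence $(r_n)_{n\in\mathbb{N}}\subset\mathbb{N}$ with $u_n\to\infty$, $r_n\to\infty$, $n\mathbb{P}(X_0>u_n)\to\infty$ and $r_n\mathbb{P}(X_0>u_n)\to0$ as $n\to\infty$, such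 that $$\lim_{n\to\infty}\frac1{\mathbb{P}(X_0>u_n)}\sum_{h=r_n}^\infty\alpha_h=0\quad\text{and}\quad\lim_{k\to\infty}\limsup_{n\to\infty}\sum_{h=k}^{r_n}\mathbb{P}(X_h>u_n\mid X_0>u_n)=0.$$ *)

(* Defs.v *)
From HB Require Import structures.
From mathcomp Require Import all_boot all_order all_algebra.
From mathcomp Require Import all_classical all_reals all_analysis.

Set Implicit Arguments.
Unset Strict Implicit.
Unset Printing Implicit Defensive.

Import Order.TTheory GRing.Theory Num.Theory.
Import numFieldNormedType.Exports.

Local Open Scope classical_set_scope.
Local Open Scope ring_scope.

(* The product Borel sigma-algebra B(R^I), generated by the one-coordinate
   cylinders. *)
Definition product_borel (R : realType) (I : Type) : set (set (I -> R)) :=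
  <<s [set C | exists (i : I) (B : set R),
         measurable B /\ C = [set x : I -> R | B (x i)]] >>.

(* A family (X_i)_{i in I} is handled through its path map w |-> (X_i w)_i. *)
Definition same_law (R : realType) (I : Type)
    (d : measure_display) (T : measurableType d) (P : probability T R)
    (X : T -> I -> R)
    (d' : measure_display) (T' : measurableType d') (P' : probability T' R)
    (X' : T' -> I -> R) : Prop :=
  forall A : set (I -> R), product_borel A -> P (X @^-1` A) = P' (X' @^-1` A).

Section time_series.
Context (R : realType) (d : measure_display) (T : measurableType d)
  (P : probability T R).
Implicit Types X : int -> {RV P >-> R}.

Definition strictly_stationary X : Prop :=
  forall s : int,
    same_law P (fun w (t : int) => X t w) P (fun w (t : int) => X (t + s) w).

(* The product rule over all n indices is enough: A i = setT is allowed. *)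
Definition independent_series (n : nat) (Y : 'I_n -> int -> {RV P >-> R}) :
    Prop :=
  forall A : 'I_n -> set (int -> R), (forall i, product_borel (A i)) ->
    P [set w | forall i, A i (fun t => Y i t w)] =
    (\prod_(i < n) P [set w | A i (fun t => Y i t w)])%E.

Definition frechet_cdf (alpha x : R) : R :=
  if 0 < x then expR (- (x `^ (- alpha))) else 0.

Definition frechet_margins (alpha : R) X : Prop :=
  forall (t : int) (x : R), P [set w | X t w <= x] = (frechet_cdf alpha x)%:E.

Definition extremal_coefficient X (theta : int -> R) : Prop :=
  forall (h : int) (x : R), 0 < x ->
    P [set w | X h w <= x /\ X 0 w <= x] =
    (fine (P [set w | X 0 w <= x]) `^ theta h)%:E.

Definition alpha_mixing X (h : nat) : \bar R :=
  ereal_sup [set x | exists A B : set (nat -> R),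
    product_borel A /\ product_borel B /\
    let E := [set w | A (fun k : nat => X (- k%:Z) w)] in
    let F := [set w | B (fun k : nat => X (h + k)%:Z w)] in
    x = `|P (E `&` F) - P E * P F|%E].

Definition exceedance X (u : R) : R := fine (P [set w | u < X 0 w]).

(* P(X_h > u | X_0 > u) *)
Definition cond_exceedance X (h : nat) (u : R) : R :=
  fine (P [set w | u < X h%:Z w /\ u < X 0 w]) / exceedance X u.

Definition intermediate X (u : nat -> R) (r : nat -> nat) : Prop :=
  [/\ u @ \oo --> +oo,
      r @ \oo --> \oo,
      (fun n : nat => n%:R * exceedance X (u n)) @ \oo --> +oo &
      (fun n : nat => (r n)%:R * exceedance X (u n)) @ \oo --> (0 : R)].

Definition condition_M X : Prop :=
  exists (u : nat -> R) (r : nat -> nat),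
    [/\ intermediate X u r,
        (fun n : nat => ((exceedance X (u n))^-1)%:E *
           \sum_(r n <= h <oo) alpha_mixing X h)%E @ \oo --> 0%E &
        (fun k : nat => limn_esup (fun n : nat =>
           (\sum_(k <= h < (r n).+1) cond_exceedance X h (u n))%:E))
          @ \oo --> 0%E].

End time_series.

(* For every number n.+1 of independent copies of X, their pointwise maximum
   has, after an affine normalization by a_t > 0 and b_t, the law of X. *)
Definition max_stable (R : realType) (d : measure_display)
    (T : measurableType d) (P : probability T R) (X : int -> {RV P >-> R}) :
    Prop :=
  forall n : nat, exists a b : int -> R,
    (forall t, 0 < a t) /\
    exists (d' : measure_display) (T' : measurableType d')
           (P' : probability T' R) (Y : 'I_n.+1 -> int -> {RV P' >-> R}),
      [/\ independent_series Y,
          (forall i, same_law P' (fun w (t : int) => Y i t w)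
                              P (fun w (t : int) => X t w)) &
          same_law
            P' (fun w (t : int) =>
              (\big[Num.max/Y ord0 t w]_(i < n.+1) Y i t w - b t) / a t)
            P (fun w (t : int) => X t w)].

(* Main.v *)
Require Import Defs.
From HB Require Import structures.
From mathcomp Require Import all_boot all_order all_algebra.
From mathcomp Require Import all_classical all_reals all_analysis.
From mathcomp Require Import ring lra.
From mathcomp Require Import measurable_realfun giry.

Set Implicit Arguments.
Unset Strict Implicit.
Unset Printing Implicit Defensive.

Import Order.TTheory GRing.Theory Num.Theory.
Import numFieldNormedType.Exports.

Local Open Scope classical_set_scope.
Local Open Scope ring_scope.

(** Why the theorem is true.

    The heart of the matter is the bound, for a stationary max-stable series,
<<
      alpha_h <= 32 sum_(i, l >= 0) (2 - theta (h + i + l))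
              =  32 sum_(q >= 0) (q + 1) (2 - theta (h + q)),
>>
    in which i and l run through the past and through the future.  Summed over
    h > r it gives at most 32 sum_(h >= 1) h ^ 2 (2 - theta (h + r)), so that the first
    hypothesis is exactly what the mixing part of condition (M) asks for, with
    r_n replaced by r_n + 1; since P(X_0 > u) is of order u ^ (- alpha), the
    normalizations agree.  The clustering part is elementary: the bivariate
    margins of X are powers of the Frechet distribution, which gives
    P(X_h > u | X_0 > u) <= P(X_0 > u) + 2 (2 - theta h) for u >= 1.

    The mixing bound is proved by a Lindeberg replacement argument, which takes
    the place of the spectral representation of X.  By max-stability, X has, for
    each n, the law of the maximum of n iid series Z_1, ..., Z_n, whose one- and
    two-dimensional margins at a common level are the n-th roots of those of X
    (max_stable_iid, copies_levels).  On the product space there is an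
    independent copy Z'_1, ..., Z'_n.  The past of max_i Z_i is kept, and in the
    future of max_i Z_i the series Z_1, ..., Z_n are replaced one at a time by
    Z'_1, ..., Z'_n.  At the start the past and the future have the joint law of
    those of X, at the end they are independent.

    In step k, exchanging Z_k and Z'_k preserves the joint law of everything
    (iid_perm).  This turns the change of P(past event, future event) into half
    of the expectation of a product of two differences of indicators, and this
    product vanishes unless Z_k or Z'_k exceeds all other series both at some
    past time s and at some future time t (pr_swap, one_swap).  For given s and t
    the probability of that is at most
    64 (2 - theta (t - s)) / n + O(1 / n ^ 2) (simultaneous_records): the maximum
    of the other series is compared with a grid of levels; it is below a low
    level only with exponentially small probability, and above such a level the
    probability of a joint exceedance by Z_k or Z'_k is controlled by theta.
    Adding up the n steps and letting n tend to infinity leaves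
    32 sum_(s, t) (2 - theta (t - s)) (finite_window_mixing).

    The error term forces the events to depend on finitely many coordinates;
    general events are approximated by such ones
    (product_borel_approximable). *)

(** * Probabilities as real numbers *)

Lemma measurable_forall (d : measure_display) (T : measurableType d)
    (J : finType) (F : J -> set T) :
  (forall j, measurable (F j)) -> measurable [set w | forall j, F j w].
Proof.
move=> mF; rewrite (_ : [set _ | _] = ~` \bigcup_(j in setT) ~` F j).
  apply: measurableC; apply: fin_bigcup_measurable => // j _.
  exact: measurableC.
apply/seteqP; split => [w Fw [j _ /=]|w Fw j]; first by apply; exact: Fw.
by apply: contrapT => nF; apply: Fw; exists j.
Qed.

Lemma measurable_exists (d : measure_display) (T : measurableType d)
    (J : finType) (F : J -> set T) :
  (forall j, measurable (F j)) -> measurable [set w | exists j, F j w].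
Proof.
move=> mF; rewrite (_ : [set _ | _] = \bigcup_(j in setT) F j).
  exact: fin_bigcup_measurable.
by apply/seteqP; split => [w [j Fj]|w [j _ Fj]]; exists j.
Qed.

Section real_probability.
Context (R : realType) (d : measure_display) (T : measurableType d)
  (P : probability T R).
Implicit Types A B C D : set T.

Definition pr A : R := fine (P A).

Lemma prE A : measurable A -> P A = (pr A)%:E.
Proof. by move=> mA; rewrite /pr fineK// fin_num_measure. Qed.

Lemma pr_ge0 A : 0 <= pr A.
Proof. exact: fine_ge0. Qed.

Lemma prT : pr setT = 1.
Proof. by rewrite /pr probability_setT. Qed.

Lemma pr_le A B : measurable A -> measurable B -> A `<=` B -> pr A <= pr B.
Proof.
by move=> mA mB AB; rewrite -lee_fin -!prE// le_measure ?inE.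
Qed.

Lemma pr_le1 A : measurable A -> pr A <= 1.
Proof. by move=> mA; rewrite -prT pr_le. Qed.

Lemma prC A : measurable A -> pr (~` A) = 1 - pr A.
Proof.
move=> mA; apply: EFin_inj; rewrite -prE; last exact: measurableC.
by rewrite probability_setC// prE.
Qed.

Lemma prUI A B : measurable A -> measurable B ->
  pr (A `|` B) + pr (A `&` B) = pr A + pr B.
Proof.
move=> mA mB.
have mI : measurable (A `&` B) by exact: measurableI.
have mU : measurable (A `|` B) by exact: measurableU.
have := @measureUfinl _ _ _ P A B mA mB.
rewrite ltey_eq fin_num_measure//= => /(_ isT).
by rewrite !prE// => -[->]; rewrite subrK.
Qed.

Lemma prU_le A B : measurable A -> measurable B ->
  pr (A `|` B) <= pr A + pr B.
Proof. by move=> mA mB; rewrite -prUI// lerDl pr_ge0. Qed.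

(** The union bound, for an event that is merely covered by the F i. *)
Lemma pr_cover (I : eqType) (s : seq I) (F : I -> set T) A :
  measurable A -> (forall i, measurable (F i)) ->
  (forall w, A w -> exists2 i, i \in s & F i w) ->
  pr A <= \sum_(i <- s) pr (F i).
Proof.
move=> mA mF; elim: s A mA => [|i s IH] A mA AF.
  rewrite big_nil (_ : A = set0) ?/pr ?measure0//.
  by apply/seteqP; split => // w /AF[].
rewrite big_cons; have mAF : measurable (A `\` F i) by exact: measurableD.
apply: (@le_trans _ _ (pr (F i) + pr (A `\` F i))).
  apply: le_trans (prU_le (mF i) mAF); apply: pr_le => //.
    exact: measurableU.
  by move=> w Aw; have [?|?] := pselect (F i w); [left|right].
rewrite lerD2l; apply: IH => // w [Aw nF].
by have [j /[!inE] /predU1P[->//|js] Fj] := AF w Aw; exists j.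
Qed.

Lemma pr_dist A B D : measurable A -> measurable B -> measurable D ->
  (forall w, ~ D w -> A w <-> B w) -> `|pr A - pr B| <= pr D.
Proof.
move=> mA mB mD AB.
have mAD : measurable (A `|` D) by exact: measurableU.
have mBD : measurable (B `|` D) by exact: measurableU.
have H1 : pr A <= pr B + pr D.
  apply: le_trans (prU_le mB mD); apply: pr_le => // w Aw.
  by have [Dw|Dw] := pselect (D w); [right|left; apply/(AB _ Dw)].
have H2 : pr B <= pr A + pr D.
  apply: le_trans (prU_le mA mD); apply: pr_le => // w Bw.
  by have [Dw|Dw] := pselect (D w); [right|left; apply/(AB _ Dw)].
by rewrite ler_norml; apply/andP; split; lra.
Qed.

End real_probability.

(** * Path spaces *)

Section path_space.
Context (R : realType).

Definition cylinder_sets (I : Type) : set (set (I -> R)) :=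
  [set C | exists (i : I) (B : set R),
     measurable B /\ C = [set x : I -> R | B (x i)]].

(** The type of paths with B(R^I) as its canonical sigma-algebra, so that the
    general results on measurable types apply to product_borel. *)
Definition path_space (I : Type) := g_sigma_algebraType (@cylinder_sets I).

Lemma product_borelE (I : Type) (A : set (I -> R)) :
  product_borel A = measurable (A : set (path_space I)).
Proof. by []. Qed.

Lemma measurable_coord (I : Type) (i : I) :
  measurable_fun setT (fun x : path_space I => x i).
Proof.
move=> _ B mB; rewrite setTI.
by apply: sub_sigma_algebra; exists i, B.
Qed.

(** It suffices to test the generators of the product sigma-algebra. *)
Lemma measurable_path d (T : measurableType d) (I : Type) (phi : T -> I -> R) :
  (forall i, measurable_fun setT (phi^~ i)) ->
  forall A, product_borel A -> measurable (phi @^-1` A).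
Proof.
move=> mphi A.
suff: (@product_borel R I) `<=` [set A | measurable (phi @^-1` A)] by apply.
apply: smallest_sub; first split.
- by rewrite /= preimage_set0.
- move=> B /= mB; rewrite setTD preimage_setC; exact: measurableC.
- move=> F mF /=; rewrite preimage_bigcup; exact: bigcupT_measurable.
move=> _ [i [B [mB ->]]] /=.
by have := mphi i measurableT B mB; rewrite setTI.
Qed.

(** Measurable changes of coordinates, e.g. relabelling the time axis. *)
Lemma product_borel_preimage (I J : Type) (phi : (I -> R) -> J -> R) :
  (forall j, measurable_fun setT ((fun x : path_space I => phi x j))) ->
  forall A, product_borel A -> product_borel (phi @^-1` A).
Proof. exact: (@measurable_path _ (path_space I)). Qed.

Lemma product_borel_reindex (I J : Type) (f : J -> I) (A : set (J -> R)) :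
  product_borel A -> product_borel [set x : I -> R | A (fun j => x (f j))].
Proof.
by apply: product_borel_preimage => j; exact: measurable_coord.
Qed.

Lemma product_borel_le (I : Type) (i : I) (x : R) :
  product_borel [set y : I -> R | y i <= x].
Proof. by apply: sub_sigma_algebra; exists i, `]-oo, x]%classic; split. Qed.

Lemma product_borel_le2 (I : Type) (i j : I) (x : R) :
  product_borel [set y : I -> R | y i <= x /\ y j <= x].
Proof.
by rewrite product_borelE; apply: measurableI; exact: product_borel_le.
Qed.

End path_space.

(** * Finite families of independent, identically distributed paths *)

Section iid.
Context (R : realType) (d : measure_display) (T : measurableType d)
  (P : probability T R) (J : finType).

Definition iid_paths (W : J -> T -> int -> R) : Prop :=
  [/\ forall j t, measurable_fun setT (W j ^~ t),
      forall A : J -> set (int -> R), (forall j, product_borel (A j)) ->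
        pr P [set w | forall j, A j (W j w)] =
        \prod_j pr P [set w | A j (W j w)] &
      forall j k (A : set (int -> R)), product_borel A ->
        pr P [set w | A (W j w)] = pr P [set w | A (W k w)]].

Let rectangles : set (set (J * int -> R)) :=
  [set C | exists A : J -> set (int -> R), (forall j, product_borel (A j)) /\
     C = [set z | forall j, A j (fun t => z (j, t))]].

Let rectangles_measurable : rectangles `<=` @product_borel R (J * int).
Proof.
move=> _ [A [mA ->]]; rewrite product_borelE; apply: measurable_forall => j.
exact: (product_borel_reindex (fun t => (j, t)) (mA j)).
Qed.

Let rectangles_generate : @product_borel R (J * int) = <<s rectangles >>.
Proof.
apply/seteqP; split.
- apply: smallest_sub; first exact: smallest_sigma_algebra.
  move=> _ [[j t] [B [mB ->]]]; apply: sub_sigma_algebra.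
  exists (fun i => if i == j then [set x : int -> R | B (x t)] else setT).
  split.
    move=> i; case: ifP => _; last first.
      by rewrite product_borelE; exact: measurableT.
    by apply: sub_sigma_algebra; exists t, B.
  apply/seteqP; split => [z Bz i|z /(_ j)]; last by rewrite eqxx.
  by case: eqP => // ->.
- apply: smallest_sub rectangles_measurable.
  exact: smallest_sigma_algebra.
Qed.

Let rectanglesI : setI_closed rectangles.
Proof.
move=> _ _ [A [mA ->]] [B [mB ->]].
exists (fun j => A j `&` B j); split.
  by move=> j; rewrite product_borelE; apply: measurableI;
    [exact: mA|exact: mB].
by apply/seteqP; split => [z [Az Bz] j|z AB]; split => // j; have [] := AB j.
Qed.

(** Rectangles form a pi-system that generates the product sigma-algebra, and
    on a rectangle both sides are the same product of one-series probabilities,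
    in a different order. *)
Lemma iid_perm (W : J -> T -> int -> R) (s : J -> J)
    (C : set (J * int -> R)) :
  involutive s -> iid_paths W -> product_borel C ->
  pr P [set w | C (fun p => W p.1 w p.2)] =
  pr P [set w | C (fun p => W (s p.1) w p.2)].
Proof.
move=> ss [mW indW idW] mC.
pose f1 w : path_space R (J * int) := fun p => W p.1 w p.2.
pose f2 w : path_space R (J * int) := fun p => W (s p.1) w p.2.
have mf1 : measurable_fun setT f1.
  by move=> _ B mB; rewrite setTI; apply: measurable_path => // -[j t]; exact: mW.
have mf2 : measurable_fun setT f2.
  by move=> _ B mB; rewrite setTI; apply: measurable_path => // -[j t]; exact: mW.
congr fine.
apply: (@measure_unique _ R (path_space R (J * int)) rectangles (fun=> setT)
  rectangles_generate rectanglesI _ _ (giry_map mf1 P) (giry_map mf2 P)) => //.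
- move=> _; exists (fun=> setT); split.
    by move=> j; rewrite product_borelE; exact: measurableT.
  by apply/seteqP; split.
- by apply/seteqP; split => // z _; exists 0%N.
- move=> _ [A [mA ->]].
  have mAW i j : measurable [set w | A i (W j w)].
    by apply: (@measurable_path _ _ _ _ (W j)).
  have mAll (g : J -> J) : measurable [set w | forall j, A j (W (g j) w)].
    by apply: measurable_forall => j; exact: mAW.
  have H : pr P [set w | forall j, A j (W j w)] =
           pr P [set w | forall j, A j (W (s j) w)].
    rewrite indW//.
    rewrite [X in _ = pr P X](_ : _ =
        [set w | forall j, A (s j) (W j w)]); last first.
      apply/seteqP; split => w Aw j; last by have := Aw (s j); rewrite ss.
      by have := Aw (s j); rewrite ss.
    rewrite (indW (fun j => A (s j)))// (reindex_inj (inv_inj ss))/=.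
    by apply: eq_bigr => j _; exact: idW.
  have mL := mAll id; have mR := mAll s.
  by have := congr1 EFin H; rewrite -!prE.
- by move=> _; rewrite -[X in (X < _)%E]/(P (f1 @^-1` setT)) preimage_setT
    probability_setT ltry.
Qed.

End iid.

(** * Elementary inequalities *)

Section inequalities.
Context (R : realType).
Implicit Types x t : R.

Lemma sub1expRN_ge0 x : 0 <= x -> 0 <= 1 - expR (- x).
Proof. by move=> x0; rewrite subr_ge0 -expR0 ler_expR oppr_le0. Qed.

Lemma sub1expRN_le x : 1 - expR (- x) <= x.
Proof. by have := expR_ge1Dx (- x); lra. Qed.

Lemma expRN_le12 x : 1 <= x -> expR (- x) <= 2^-1.
Proof.
move=> x1; rewrite expRN lef_pV2 ?posrE ?expR_gt0//.
by have := expR_ge1Dx x; lra.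
Qed.

(** With t = 2 the left-hand side is a square; the deviation from independence
    is what costs (2 - t) x. *)
Lemma joint_tail_le_sqr x t : 0 <= x -> 0 <= t -> t <= 2 ->
  1 - 2 * expR (- x) + expR (- (t * x)) <= (1 - expR (- x)) ^+ 2 + (2 - t) * x.
Proof.
move=> x0 t0 t2.
have -> : 1 - 2 * expR (- x) + expR (- (t * x)) =
    (1 - expR (- x)) ^+ 2 + expR (- (t * x)) * (1 - expR (- ((2 - t) * x))).
  rewrite mulrBr mulr1 -expRD.
  have -> : - (t * x) + - ((2 - t) * x) = - x + - x by ring.
  by rewrite expRD; ring.
rewrite lerD2l.
have y0 : 0 <= (2 - t) * x by rewrite mulr_ge0// subr_ge0.
apply: (@le_trans _ _ (1 * (1 - expR (- ((2 - t) * x))))); last first.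
  by rewrite mul1r; exact: sub1expRN_le.
rewrite ler_wpM2r ?sub1expRN_ge0//.
by rewrite -expR0 ler_expR oppr_le0 mulr_ge0.
Qed.

Lemma joint_tail_le x t : 0 <= x -> 0 <= t -> t <= 2 ->
  1 - 2 * expR (- x) + expR (- (t * x)) <= x ^+ 2 + (2 - t) * x.
Proof.
move=> x0 t0 t2; apply: le_trans (joint_tail_le_sqr x0 t0 t2) _.
by rewrite lerD2r ler_sqr ?nnegrE ?sub1expRN_ge0//; exact: sub1expRN_le.
Qed.

Lemma sub1expRN_ge_half x : 0 <= x -> x <= 1 -> x / 2 <= 1 - expR (- x).
Proof.
move=> x0 x1; suff : expR (- x) <= 1 - x / 2 by lra.
rewrite expRN invf_ple ?posrE ?expR_gt0//; last by lra.
apply: le_trans (expR_ge1Dx x); rewrite -div1r ler_pdivrMr; last by lra.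
nra.
Qed.

(** The joint tail at x = 1 / n is (2 - t) x + O(x ^ 2). *)
Lemma joint_tail_ge0_le2 t : 0 <= t ->
  (forall n, 0 <= 1 - 2 * expR (- n.+1%:R^-1) + expR (- (t / n.+1%:R))) ->
  t <= 2.
Proof.
move=> t0 H; rewrite leNgt; apply/negP => t2.
pose c := expR (- t) * (t - 2).
have c0 : 0 < c by rewrite mulr_gt0 ?expR_gt0// subr_gt0.
pose n := Num.truncn c^-1.
have nc : n.+1%:R^-1 < c.
  by rewrite invf_plt ?posrE//; exact: truncnS_gt.
move: (H n); set x := n.+1%:R^-1 in nc *.
have x0 : 0 < x by rewrite invr_gt0.
have x1 : x <= 1 by rewrite invf_le1// ler1n.
have -> : 1 - 2 * expR (- x) + expR (- (t * x)) =
    (1 - expR (- x)) ^+ 2 + expR (- (t * x)) * (1 - expR ((t - 2) * x)).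
  rewrite mulrBr mulr1 -expRD.
  have -> : - (t * x) + (t - 2) * x = - x + - x by ring.
  by rewrite expRD; ring.
have h1 : (1 - expR (- x)) ^+ 2 <= x ^+ 2.
  by rewrite ler_sqr ?nnegrE ?sub1expRN_ge0 ?(ltW x0)//; exact: sub1expRN_le.
have h2 : expR (- t) * ((t - 2) * x) <=
    expR (- (t * x)) * (expR ((t - 2) * x) - 1).
  apply: ler_pM; rewrite ?expR_ge0 ?mulr_ge0 ?subr_ge0 ?(ltW t2) ?(ltW x0)//.
    by rewrite ler_expR lerN2 ler_piMr.
  by have := expR_ge1Dx ((t - 2) * x); lra.
have h3 : x ^+ 2 < c * x by rewrite expr2 ltr_pM2r.
rewrite /c in h3; lra.
Qed.

End inequalities.

Lemma le_of_le_harmonic (R : realType) (c s k : R) :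
  (forall n, c <= s + k / n.+2%:R) -> c <= s.
Proof.
move=> H; apply/ler_addgt0Pr => e e0.
pose n := Num.truncn (`|k| / e).
apply: le_trans (H n) _; rewrite lerD2l ler_pdivrMr//.
apply: le_trans (ler_norm k) _.
have : `|k| / e <= n.+2%:R.
  by apply: ltW; apply: lt_trans (truncnS_gt _) _; rewrite ltr_nat.
by rewrite ler_pdivrMr// mulrC.
Qed.

(** * Exceedances in an iid family *)

Section exceedances.
Context (R : realType) (d : measure_display) (T : measurableType d)
  (P : probability T R) (J : finType) (W : J -> T -> int -> R).
Hypothesis iidW : iid_paths P W.
Implicit Types (s : int) (S Q : {pred J}).

Let mW j t : measurable_fun setT (W j ^~ t).
Proof. by case: iidW. Qed.

Let mAW j A : product_borel A -> measurable [set w | A (W j w)].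
Proof. by apply: (@measurable_path _ _ _ _ (W j)) => t; exact: mW. Qed.

Lemma measurable_all_in S A : product_borel A ->
  measurable [set w | forall j, j \in S -> A (W j w)].
Proof.
move=> mA.
apply: (measurable_forall (F := fun j => [set w | j \in S -> A (W j w)])) => j.
have [jS|jS] := boolP (j \in S).
  by rewrite (_ : [set _ | _] = [set w | A (W j w)]);
    [exact: mAW|apply/seteqP; split => w //=; exact].
by rewrite (_ : [set _ | _] = setT);
  [exact: measurableT|apply/seteqP; split => w //=].
Qed.

(** The independence hypothesis, specialized to two groups of indices with a
    common constraint on each group; all other indices are unconstrained. *)
Lemma pr_all_in2 (j0 : J) S Q A B : product_borel A -> product_borel B ->
  (forall j, j \in S -> j \notin Q) ->
  pr P ([set w | forall j, j \in S -> A (W j w)] `&`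
        [set w | forall j, j \in Q -> B (W j w)]) =
  pr P [set w | A (W j0 w)] ^+ #|S| * pr P [set w | B (W j0 w)] ^+ #|Q|.
Proof.
move=> mA mB SQ; case: iidW => _ ind idt.
pose C j : set (int -> R) :=
  if j \in S then A else if j \in Q then B else setT.
have mC j : product_borel (C j).
  rewrite /C; case: ifP => // _; case: ifP => // _.
  by rewrite product_borelE; exact: measurableT.
rewrite (_ : _ `&` _ = [set w | forall j, C j (W j w)]).
  rewrite ind// (bigID (mem S))/=; congr (_ * _).
    rewrite (eq_bigr (fun=> pr P [set w | A (W j0 w)])).
      by rewrite prodr_const.
    by move=> j jS; rewrite /C jS; exact: idt.
  rewrite (bigID (mem Q))/= [X in _ * X]big1 ?mulr1.
    rewrite (eq_big (mem Q) (fun=> pr P [set w | B (W j0 w)])).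
    - by rewrite prodr_const.
    - by move=> j; case: (boolP (j \in S)) => //= /SQ/negbTE ->.
    - by move=> j /andP[/negbTE jS jQ]; rewrite /C jS jQ; exact: idt.
  by move=> j /andP[/negbTE jS /negbTE jQ]; rewrite /C jS jQ; exact: prT.
apply/seteqP; split => w.
  by move=> [/= AS BQ] j; rewrite /C; case: ifP => [/AS//|_]; case: ifP => // /BQ.
move=> Cw; split => j jS; have := Cw j; rewrite /C ?jS//.
by case: ifPn => // /SQ; rewrite jS.
Qed.

Variables (a b : J).
Hypothesis ab : a != b.

Definition low S s (x : R) : set T := [set w | forall j, j \in S -> W j w s <= x].

Lemma measurable_low S s x : measurable (low S s x).
Proof. exact: (measurable_all_in S (product_borel_le s x)). Qed.

(** At time s1 and at time s2, the larger of W a and W b exceeds x; the two times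
    need not be served by the same series. *)
Definition high2 s1 s2 (x : R) : set T :=
  ~` (low (pred2 a b) s1 x `|` low (pred2 a b) s2 x).

Lemma measurable_high2 s1 s2 x : measurable (high2 s1 s2 x).
Proof. by apply/measurableC/measurableU; exact: measurable_low. Qed.

Lemma pr_low S s x : pr P (low S s x) = pr P [set w | W a w s <= x] ^+ #|S|.
Proof.
have := @pr_all_in2 a S pred0 _ _ (product_borel_le s x) (product_borel_le s x).
rewrite card0 expr0 mulr1 => <-//.
by congr (pr P _); apply/seteqP; split => [w Sw|w []//]; split.
Qed.

(** The last factor is the probability of high2 by inclusion and exclusion.
    The event high2 only involves the indices a and b, so that it is
    independent of low S when S avoids them. *)
Lemma pr_low_high2 S s s1 s2 x y : (forall j, j \in S -> j \notin pred2 a b) ->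
  pr P (low S s x `&` high2 s1 s2 y) =
  pr P (low S s x) *
  (1 - pr P [set w | W a w s1 <= y] ^+ 2 - pr P [set w | W a w s2 <= y] ^+ 2
     + pr P [set w | W a w s1 <= y /\ W a w s2 <= y] ^+ 2).
Proof.
move=> Sab; set L := low S s x.
set M1 := low (pred2 a b) s1 y; set M2 := low (pred2 a b) s2 y.
have [mL mM1 mM2] : [/\ measurable L, measurable M1 & measurable M2].
  by split; exact: measurable_low.
have c2 : #|pred2 a b| = 2%N by rewrite card2 ab.
have e1 : pr P (L `&` M1) = pr P L * pr P [set w | W a w s1 <= y] ^+ 2.
  by rewrite -c2 pr_low; exact: (pr_all_in2 a (product_borel_le s x) (product_borel_le s1 y) Sab).
have e2 : pr P (L `&` M2) = pr P L * pr P [set w | W a w s2 <= y] ^+ 2.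
  by rewrite -c2 pr_low; exact: (pr_all_in2 a (product_borel_le s x) (product_borel_le s2 y) Sab).
have e12 : pr P (L `&` M1 `&` (L `&` M2)) =
    pr P L * pr P [set w | W a w s1 <= y /\ W a w s2 <= y] ^+ 2.
  rewrite -c2 pr_low -(pr_all_in2 a (product_borel_le s x) (product_borel_le2 s1 s2 y) Sab).
  congr (pr P _); apply/seteqP; split => [w [[Lw M1w] [_ M2w]]|w [Lw Mw]].
    by split => // j jab; split; [exact: M1w|exact: M2w].
  by split; split => // j jab; have [] := Mw j jab.
have eU : pr P L = pr P (L `&` high2 s1 s2 y) + pr P (L `&` M1 `|` L `&` M2).
  have e0 : (L `&` (M1 `|` M2)) `&` (L `&` high2 s1 s2 y) = set0.
    by apply/seteqP; split => // w [[_ ?] [_ ]].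
  have := @prUI _ _ _ P (L `&` (M1 `|` M2)) (L `&` high2 s1 s2 y).
  rewrite -setIUr /high2 setUCr setIT e0 [pr P set0]/pr measure0 addr0 setIUr.
  rewrite addrC; apply; last exact: measurableI _ (measurable_high2 _ _ _).
  by apply: measurableU; exact: measurableI.
have := prUI P (measurableI _ _ mL mM1) (measurableI _ _ mL mM2).
rewrite e12 e1 e2 => eI.
lra.
Qed.

End exceedances.

(** * Simultaneous records *)

Section geometric_sums.
Context (R : realType).

Let quarter_sum n : \sum_(0 <= j < n) 4^-1 ^+ j <= 4 / 3 :> R.
Proof.
suff -> : \sum_(0 <= j < n) 4^-1 ^+ j = 4 / 3 * (1 - 4^-1 ^+ n) :> R.
  by rewrite ler_piMr// ?divr_ge0// gerBl exprn_ge0// invr_ge0.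
elim: n => [|n IH]; first by rewrite big_geq// expr0 subrr mulr0.
by rewrite big_nat_recr//= IH exprS; field.
Qed.

Let succ_le_exp2 j : j.+1%:R <= 2 ^+ j :> R.
Proof. by rewrite -natrX ler_nat; exact: ltn_expl. Qed.

Lemma sum_quad_geometric n :
  \sum_(0 <= j < n) 16^-1 ^+ j * j.+1%:R ^+ 2 <= 2 :> R.
Proof.
apply: le_trans (_ : \sum_(0 <= j < n) 4^-1 ^+ j <= _); last first.
  by apply: le_trans (quarter_sum n) _; lra.
apply: ler_sum => j _.
have -> : 4^-1 ^+ j = 16^-1 ^+ j * (2 ^+ j) ^+ 2 :> R.
  by rewrite -exprM mulnC exprM -exprMn; congr (_ ^+ j); field.
rewrite ler_wpM2l ?exprn_ge0 ?invr_ge0// ler_sqr ?nnegrE//.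
Qed.

Lemma sum_lin_geometric n :
  \sum_(0 <= j < n) 16^-1 ^+ j * j.+1%:R <= 2 :> R.
Proof.
apply: le_trans (sum_quad_geometric n); apply: ler_sum => j _.
rewrite ler_wpM2l ?exprn_ge0 ?invr_ge0// expr2 ler_peMr//.
by rewrite ler1n.
Qed.

Lemma pow16_le_sqr n : 16^-1 ^+ n.+1 <= n.+1%:R ^- 2 :> R.
Proof.
rewrite exprVn lef_pV2 ?posrE ?exprn_gt0//.
apply: (@le_trans _ _ ((2 ^+ n.+1) ^+ 2)).
  rewrite ler_sqr ?nnegrE// ?exprn_ge0//.
  by apply: le_trans (succ_le_exp2 _); rewrite ler_nat.
by rewrite -exprM mulnC exprM lerXn2r// ?nnegrE//; lra.
Qed.

End geometric_sums.

Section simultaneous_records.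
Context (R : realType) (d : measure_display) (T : measurableType d)
  (P : probability T R) (J : finType) (W : J -> T -> int -> R).
Hypothesis iidW : iid_paths P W.
Variables (a b : J) (S1 S2 : {pred J}) (n : nat) (s1 s2 : int).
Hypothesis ab : a != b.
Hypotheses (S1ab : forall j, j \in S1 -> j \notin pred2 a b)
  (S2ab : forall j, j \in S2 -> j \notin pred2 a b).
Hypotheses (cardS1 : #|S1| = n.+1) (cardS2 : #|S2| = n.+1).
Variables (theta : R) (level : nat -> R).
Hypotheses (theta0 : 0 <= theta) (theta2 : theta <= 2).
Local Notation N := (n.+2%:R : R).
Hypothesis level1 : forall j,
  pr P [set w | W a w s1 <= level j.+1] = expR (- (8 * j.+1%:R / N)).
Hypothesis level2 : forall j,
  pr P [set w | W a w s2 <= level j.+1] = expR (- (8 * j.+1%:R / N)).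
Hypothesis level12 : forall j,
  pr P [set w | W a w s1 <= level j.+1 /\ W a w s2 <= level j.+1] =
  expR (- (theta * (8 * j.+1%:R / N))).

(** At one of the two times, the maximum of the other series has not passed level
    j. Level 0 is a fictitious level that no series passes. *)
Let early j : set T :=
  if j is j'.+1 then low W S1 s1 (level j) `|` low W S2 s2 (level j) else setT.

Let mearly j : measurable (early j).
Proof.
case: j => [|j] /=; first exact: measurableT.
by apply: measurableU; exact: measurable_low iidW _ _ _.
Qed.

(** Once both maxima have passed level j.+1, as is the case when j is the last
    index with early j, a simultaneous record exceeds this level at both times. *)
Let piece j : set T := early j `&` high2 W a b s1 s2 (level j.+1).

Let mpiece j : measurable (piece j).
Proof. by apply: measurableI => //; exact: measurable_high2 iidW _ _ _ _ _. Qed.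

Let cover k : set T := early k `|` [set w | exists j : 'I_k, piece j w].

Let mcover k : measurable (cover k).
Proof.
apply: measurableU => //.
exact: measurable_exists.
Qed.

(** As long as both maxima of the other series have passed the level, the larger
    of W a and W b, which beats them, exceeds it too. *)
Let records_cover k w :
  (forall j, j \in S1 -> W j w s1 < Num.max (W a w s1) (W b w s1)) ->
  (forall j, j \in S2 -> W j w s2 < Num.max (W a w s2) (W b w s2)) ->
  cover k w.
Proof.
move=> H1 H2; elim: k => [|k IH]; first by left.
have [E|nE] := pselect (early k.+1 w); first by left.
right; case: IH => [Ek|[j pj]]; last by exists (widen_ord (leqnSn k) j).
exists ord_max; split => //= H; apply: nE.
have lt_absurd S s : (forall j, j \in S -> W j w s < Num.max (W a w s) (W b w s)) ->
    low W (pred2 a b) s (level k.+1) w -> low W S s (level k.+1) w.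
  move=> HS Hab j jS; apply: le_trans (ltW (HS j jS)) _.
  by rewrite ge_max !Hab// !inE eqxx ?orbT.
by case: H => H; [left|right]; exact: lt_absurd H.
Qed.

Let x j : R := 16 * j.+1%:R / N.

Let N0 : 0 < N. Proof. by rewrite ltr0n. Qed.

Let x0 j : 0 <= x j.
Proof. by rewrite /x divr_ge0// mulr_ge0. Qed.

Let tail j :=
  1 - pr P [set w | W a w s1 <= level j.+1] ^+ 2
    - pr P [set w | W a w s2 <= level j.+1] ^+ 2
    + pr P [set w | W a w s1 <= level j.+1 /\ W a w s2 <= level j.+1] ^+ 2.

Let tail_le j : tail j <= x j ^+ 2 + (2 - theta) * x j.
Proof.
rewrite /tail level1 level2 level12 -!expRM_natl.
have -> : 2%:R * - (8 * j.+1%:R / N) = - x j by rewrite /x; ring.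
have -> : 2%:R * - (theta * (8 * j.+1%:R / N)) = - (theta * x j).
  by rewrite /x; ring.
by have := joint_tail_le (x0 j) theta0 theta2; lra.
Qed.

(* The N - 1 other series leave the exponent 8 (j + 1) (N - 1) / N, which is at
   least 4 (j + 1), and expR (- 4) <= 1 / 16. *)
Let low_le S s j : #|S| = n.+1 ->
  pr P [set w | W a w s <= level j.+1] = expR (- (8 * j.+1%:R / N)) ->
  pr P (low W S s (level j.+1)) <= 16^-1 ^+ j.+1.
Proof.
move=> cS e; rewrite (pr_low iidW a) cS e -expRM_natl.
apply: (@le_trans _ _ (expR (j.+1%:R * (- 4)))).
  rewrite ler_expR mulrN mulrN lerN2 mulrCA (mulrC 8) -!mulrA ler_wpM2l//.
  rewrite mulrA ler_pdivlMr//.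
  have : (1 : R) <= n.+1%:R by rewrite ler1n.
  by rewrite -(natr1 n.+1); lra.
rewrite expRM_natl lerXn2r ?nnegrE ?expR_ge0 ?invr_ge0//.
have -> : - 4 = 4%:R * - 1 :> R by rewrite mulrN1.
rewrite expRM_natl.
have -> : 16^-1 = 2^-1 ^+ 4 :> R by rewrite exprVn -natrX.
by rewrite lerXn2r ?nnegrE ?expR_ge0 ?invr_ge0//; exact: expRN_le12.
Qed.

Let early_le j : pr P (early j) <= 2 * 16^-1 ^+ j.
Proof.
case: j => [|j]; first by rewrite /early prT expr0; lra.
apply: le_trans (prU_le _ _ _) _; [exact: measurable_low iidW _ _ _..|].
by rewrite mulr2n mulrDl mul1r lerD// low_le.
Qed.

Let piece_le j : pr P (piece j) <= 2 * 16^-1 ^+ j * (x j ^+ 2 + (2 - theta) * x j).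
Proof.
have tail0 : 0 <= tail j.
  have := @pr_low_high2 _ _ _ _ _ _ iidW _ _ ab pred0 0 s1 s2 0 (level j.+1).
  rewrite (pr_low iidW a) card0 expr0 mul1r -/(tail j) => <- //.
  exact: pr_ge0.
apply: (@le_trans _ _ (2 * 16^-1 ^+ j * tail j)); last first.
  by rewrite ler_wpM2l ?tail_le// mulr_ge0// exprn_ge0// invr_ge0.
case: j tail0 => [|j] tail0.
  rewrite expr0 mulr1 /piece /early setTI.
  have := @pr_low_high2 _ _ _ _ _ _ iidW _ _ ab pred0 0 s1 s2 0 (level 1).
  rewrite (pr_low iidW a) card0 expr0 mul1r -/(tail 0) => <- //.
  rewrite (_ : low _ _ _ _ = setT) ?setTI; last by apply/seteqP; split.
  by rewrite ler_peMl ?pr_ge0// ler1n.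
have e S s : (forall i, i \in S -> i \notin pred2 a b) -> 
  pr P (low W S s (level j.+1) `&` high2 W a b s1 s2 (level j.+2)) =
  pr P (low W S s (level j.+1)) * tail j.+1.
  by move=> Sab; exact: (pr_low_high2 iidW).
rewrite /piece /early setIUl; apply: le_trans (prU_le _ _ _) _.
- by apply: measurableI;
    [exact: measurable_low iidW _ _ _|exact: measurable_high2 iidW _ _ _ _ _].
- by apply: measurableI;
    [exact: measurable_low iidW _ _ _|exact: measurable_high2 iidW _ _ _ _ _].
rewrite !e// -mulrDl ler_wpM2r// mulr2n mulrDl mul1r.
by apply: lerD; exact: low_le.
Qed.

Let pr_records_cover :
  pr P (cover n.+2) <= 64 * (2 - theta) / N + 1026 / N ^+ 2.
Proof.
have mU : measurable [set w | exists j : 'I_n.+2, piece j w].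
  exact: measurable_exists.
apply: le_trans (prU_le _ (mearly _) mU) _.
have Ule : pr P [set w | exists j : 'I_n.+2, piece j w] <=
    \sum_(0 <= j < n.+2) pr P (piece j).
  rewrite big_mkord -[leRHS]big_enum; apply: pr_cover => // w [j pj].
  by exists j => //; rewrite mem_enum.
have sum_le : \sum_(0 <= j < n.+2) pr P (piece j) <=
    512 / N ^+ 2 * \sum_(0 <= j < n.+2) 16^-1 ^+ j * j.+1%:R ^+ 2 +
    32 * (2 - theta) / N * \sum_(0 <= j < n.+2) 16^-1 ^+ j * j.+1%:R.
  rewrite !mulr_sumr -big_split/=; apply: ler_sum => j _.
  apply: le_trans (piece_le j) _; rewrite le_eqVlt; apply/orP; left; apply/eqP.
  by rewrite /x; field; rewrite gt_eqF.
have := early_le n.+2; have := pow16_le_sqr R n.+1.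
have c1 : 0 <= 512 / N ^+ 2 by rewrite divr_ge0// exprn_ge0.
have c2 : 0 <= 32 * (2 - theta) / N.
  by rewrite divr_ge0// mulr_ge0// subr_ge0.
have := ler_wpM2l c1 (sum_quad_geometric R n.+2).
have := ler_wpM2l c2 (sum_lin_geometric R n.+2).
move: (16^-1 ^+ n.+2) (N ^- 2) N^-1 sum_le => e i2 i1.
move: (\sum_(0 <= j < n.+2) pr P (piece j)) Ule => Sp Up h1 h2 h3 h4 h5.
have h6 := le_trans h1 (lerD h3 h2).
apply: le_trans (lerD h5 (le_trans Up h6)) _.
have -> : 64 * (2 - theta) * i1 + 1026 * i2 =
  2 * i2 + (512 * i2 * 2 + 32 * (2 - theta) * i1 * 2) by ring.
by rewrite lerD2r; lra.
Qed.

(** The event is described by an inclusion into a measurable set C, which is all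
    that a union bound needs.  The numbers 8 (j + 1) / N are the exponents of the
    N-th root of a distribution function at a level where that function is
    expR (- 8 (j + 1)). *)
Lemma simultaneous_records : exists C : set T,
  [/\ measurable C,
      forall w, (forall j, j \in S1 -> W j w s1 < Num.max (W a w s1) (W b w s1)) ->
        (forall j, j \in S2 -> W j w s2 < Num.max (W a w s2) (W b w s2)) -> C w &
      pr P C <= 64 * (2 - theta) / N + 1026 / N ^+ 2].
Proof.
exists (cover n.+2); split; [exact: mcover| |exact: pr_records_cover].
by move=> w; exact: records_cover.
Qed.

End simultaneous_records.

(** * Pointwise maxima *)

Section maxima.
Context (R : realType) (n : nat).
Implicit Types F G : 'I_n.+1 -> R.

Definition maxfam F : R := \big[Num.max/F ord0]_(i < n.+1) F i.

Lemma maxfam_leP F x : reflect (forall i, F i <= x) (maxfam F <= x).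
Proof.
apply: (iffP idP) => [|H].
  by move=> /bigmax_leP[_ H] i; exact: H.
by apply/bigmax_leP; split => [|i _]; exact: H.
Qed.

(** Changing one member matters only if its old or its new value is a strict
    record among the other ones. *)
Lemma maxfam_change F G k : (forall i, i != k -> F i = G i) ->
  maxfam F != maxfam G -> forall i, i != k -> F i < Num.max (F k) (G k).
Proof.
move=> FG /eqP nFG i ik; rewrite ltNge; apply/negP; rewrite ge_max => /andP[Fk Gk].
apply: nFG; apply/eqP; rewrite eq_le; apply/andP; split; apply/maxfam_leP => j.
- have [->|jk] := eqVneq j k; last by rewrite FG//; exact/maxfam_leP.
  by apply: le_trans Fk _; rewrite FG//; exact/maxfam_leP.
- have [->|jk] := eqVneq j k; last by rewrite -FG//; exact/maxfam_leP.
  by apply: le_trans Gk _; exact/maxfam_leP.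
Qed.

Lemma measurable_maxfam d (T : measurableType d) (F : 'I_n.+1 -> T -> R) :
  (forall i, measurable_fun setT (F i)) ->
  measurable_fun setT (fun w => maxfam (F ^~ w)).
Proof.
move=> mF; rewrite /maxfam.
elim: (index_enum _) => [|i s IH].
  by under eq_fun do rewrite big_nil; exact: mF.
by under eq_fun do rewrite big_cons; exact: measurable_maxr.
Qed.

End maxima.

(** * Decoupling by successive swaps *)

(** Off D one of the two differences of indicators A - A' and B - B' vanishes, so
    that (A - A') (B - B') is bounded by the indicator of D. *)
Lemma pr_swap (R : realType) d (T : measurableType d) (P : probability T R)
    (A A' B B' D : set T) :
  measurable A -> measurable A' -> measurable B -> measurable B' ->
  measurable D ->
  (forall w, ~ D w -> (A w <-> A' w) \/ (B w <-> B' w)) ->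
  pr P (A `&` B) + pr P (A' `&` B') <=
  pr P (A `&` B') + pr P (A' `&` B) + pr P D.
Proof.
move=> mA mA' mB mB' mD H.
have [m1 m2 m3 m4] : [/\ measurable (A `&` B), measurable (A' `&` B'),
    measurable (A `&` B') & measurable (A' `&` B)].
  by split; exact: measurableI.
rewrite -(prUI P m1 m2) -(prUI P m3 m4).
have h1 : pr P (A `&` B `|` A' `&` B') <=
    pr P (A `&` B' `|` A' `&` B) + pr P D.
  apply: le_trans (prU_le P (measurableU _ _ m3 m4) mD).
  apply: pr_le; [exact: measurableU|apply: measurableU => //; exact: measurableU|].
  move=> w ABw; have [Dw|/H Dw] := pselect (D w); [by right|left].
  by case: ABw => -[a b]; case: Dw => -[e1 e2];
    try (by left; split; auto); by right; split; auto.
have h2 : pr P (A `&` B `&` (A' `&` B')) <= pr P (A `&` B' `&` (A' `&` B)).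
  apply: pr_le; [exact: measurableI..|].
  by move=> w [[? ?] [? ?]].
lra.
Qed.

Definition depends_below (R : Type) (p : nat) (A : set (nat -> R)) :=
  forall x y : nat -> R, (forall i, (i < p)%N -> x i = y i) -> A x -> A y.

Section decoupling.
Context (R : realType) (d : measure_display) (T : measurableType d)
  (P : probability T R) (n : nat).
Variable W : 'I_n.+2 * bool -> T -> int -> R.
Hypothesis iidW : iid_paths P W.
Local Notation N := (n.+2%:R : R).
Variable tau : nat -> R.
Hypotheses (tau0 : forall m, 0 <= tau m) (tau2 : forall m, tau m <= 2).
Hypothesis levels : forall v, 0 < v -> exists x, forall j,
  (forall t, pr P [set w | W j w t <= x] = expR (- (v / N))) /\
  (forall t (m : nat), pr P [set w | W j w t <= x /\ W j w (t + m%:Z) <= x] =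
     expR (- (tau m * (v / N)))).
Variables (A B : set (nat -> R)) (p h : nat).
Hypotheses (mA : product_borel A) (mB : product_borel B).
Hypotheses (Ap : depends_below p A) (Bp : depends_below p B).

(** The first k of the second group of series replace those of the first. *)
Definition mixed_max (k : nat) (w : T) (t : int) : R :=
  maxfam (fun i : 'I_n.+2 => W (i, (i < k)%N) w t).

Definition past_event (V : T -> int -> R) : set T :=
  [set w | A (fun s : nat => V w (- s%:Z))].
Definition future_event (V : T -> int -> R) : set T :=
  [set w | B (fun s : nat => V w (h + s)%:Z)].

Let mW j t : measurable_fun setT (W j ^~ t).
Proof. by case: iidW. Qed.

Lemma measurable_past (f : 'I_n.+2 -> 'I_n.+2 * bool) :
  measurable (past_event (fun w t => maxfam (fun i => W (f i) w t))).
Proof.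
apply: (@measurable_path _ _ _ _
  (fun w (s : nat) => maxfam (fun i => W (f i) w (- s%:Z)))) => // s.
by apply: measurable_maxfam => i; exact: mW.
Qed.

Lemma measurable_future (f : 'I_n.+2 -> 'I_n.+2 * bool) :
  measurable (future_event (fun w t => maxfam (fun i => W (f i) w t))).
Proof.
apply: (@measurable_path _ _ _ _
  (fun w (s : nat) => maxfam (fun i => W (f i) w (h + s)%:Z))) => // s.
by apply: measurable_maxfam => i; exact: mW.
Qed.

Section one_swap.
Variable k : 'I_n.+2.

Let swap (j : 'I_n.+2 * bool) := if j.1 == k then (j.1, ~~ j.2) else j.

Let swapK : involutive swap.
Proof.
by case=> i b; rewrite /swap/=; case: (boolP (i == k)) => [ik|/negbTE ik]/=;
  rewrite ik ?negbK.
Qed.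

Let swapped w t := maxfam (fun i : 'I_n.+2 => W (swap (i, false)) w t).

Let swap_mixed (i : 'I_n.+2) : swap (i, (i < k)%N) = (i, (i < k.+1)%N).
Proof.
rewrite /swap/=; have [->|ik] := eqVneq i k; first by rewrite ltnn ltnS leqnn.
by rewrite [in RHS]ltnS [in RHS]leq_eqVlt (negbTE (ik : i != k :> nat)).
Qed.

Let swap_mixedS (i : 'I_n.+2) : swap (i, (i < k.+1)%N) = (i, (i < k)%N).
Proof. by rewrite -swap_mixed swapK. Qed.

Let pr_exchange (f g : 'I_n.+2 -> 'I_n.+2 * bool) :
  pr P (past_event (fun w t => maxfam (fun i => W (f i) w t)) `&`
        future_event (fun w t => maxfam (fun i => W (g i) w t))) =
  pr P (past_event (fun w t => maxfam (fun i => W (swap (f i)) w t)) `&`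
        future_event (fun w t => maxfam (fun i => W (swap (g i)) w t))).
Proof.
pose C := [set z : 'I_n.+2 * bool * int -> R |
  A (fun s : nat => maxfam (fun i => z (f i, - s%:Z))) /\
  B (fun s : nat => maxfam (fun i => z (g i, (h + s)%:Z)))].
have mC : product_borel C.
  rewrite product_borelE; apply: measurableI.
    apply: (product_borel_preimage (phi := fun z (s : nat) =>
      maxfam (fun i => z (f i, - s%:Z)))) => // s.
    by apply: measurable_maxfam => i; exact: measurable_coord.
  apply: (product_borel_preimage (phi := fun z (s : nat) =>
    maxfam (fun i => z (g i, (h + s)%:Z)))) => // s.
  by apply: measurable_maxfam => i; exact: measurable_coord.
exact: (iid_perm swapK iidW mC).
Qed.

(** With a prime for the effect of exchanging series k of the two groups,
    invariance of the law under the exchange gives P(a b) = P(a' b') and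
    P(a b') = P(a' b), so that pr_swap bounds twice the left-hand side. *)
Lemma one_swap :
  `|pr P (past_event (mixed_max 0) `&` future_event (mixed_max k)) -
    pr P (past_event (mixed_max 0) `&` future_event (mixed_max k.+1))| <=
  2^-1 * \sum_(i < p) \sum_(l < p)
     (64 * (2 - tau (h + i + l)) / N + 1026 / N ^+ 2).
Proof.
have mixed0 : mixed_max 0 = fun w t => maxfam (fun i => W (i, false) w t).
  by [].
set a := past_event _; set b := future_event _; set b' := future_event (mixed_max k.+1).
pose a' := past_event swapped.
have e1 : pr P (a `&` b) = pr P (a' `&` b').
  rewrite /a /b mixed0 pr_exchange; congr (pr P (_ `&` future_event _)).
  apply/funext => w; apply/funext => t; rewrite /mixed_max.
  by under eq_fun do rewrite swap_mixed.
have e2 : pr P (a `&` b') = pr P (a' `&` b).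
  rewrite /a /b' mixed0 pr_exchange; congr (pr P (_ `&` future_event _)).
  apply/funext => w; apply/funext => t; rewrite /mixed_max.
  by under eq_fun do rewrite swap_mixedS.
have [level levelP] : exists level : nat -> R, forall j q,
    (forall t, pr P [set w | W q w t <= level j.+1] =
      expR (- (8 * j.+1%:R / N))) /\
    (forall t (m : nat), pr P [set w | W q w t <= level j.+1 /\
      W q w (t + m%:Z) <= level j.+1] =
      expR (- (tau m * (8 * j.+1%:R / N)))).
  have /choice[lev levP] : forall j : nat, exists x, forall q,
    (forall t, pr P [set w | W q w t <= x] = expR (- (8 * j.+1%:R / N))) /\
    (forall t (m : nat), pr P [set w | W q w t <= x /\ W q w (t + m%:Z) <= x] =
      expR (- (tau m * (8 * j.+1%:R / N)))).
    by move=> j; apply: levels; rewrite mulr_gt0.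
  by exists (fun j => lev j.-1) => j q; exact: levP.
pose S1 : {pred 'I_n.+2 * bool} := [pred j | (j.1 != k) && (j.2 == false)].
pose S2 : {pred 'I_n.+2 * bool} := [pred j | (j.1 != k) && (j.2 == (j.1 < k)%N)].
have card_graph (f : 'I_n.+2 -> bool) (S : {pred 'I_n.+2 * bool}) :
    (forall j, (j \in S) = (j.1 != k) && (j.2 == f j.1)) -> #|S| = n.+1.
  move=> Sf; rewrite -[RHS]/(n.+2.-1) -[in RHS](card_ord n.+2) -(cardC1 k).
  rewrite -[RHS](card_in_image (f := fun i => (i, f i))); last by move=> i j _ _ [].
  apply: eq_card => -[i c]; rewrite Sf/=; apply/idP/idP => [/andP[ik /eqP ->]|].
    by apply/mapP; exists i; rewrite // mem_enum inE.
  by case/mapP => j /[!(mem_enum, inE)] jk [-> ->]; rewrite jk eqxx.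
have Sk (S : {pred 'I_n.+2 * bool}) : (forall j, j \in S -> j.1 != k) ->
    forall j, j \in S -> j \notin pred2 (k, false) (k, true).
  by move=> H j /H jk; rewrite !inE !negb_or; apply/andP; split;
    apply: contraNneq jk => ->.
have HC (il : 'I_p * 'I_p) : exists C : set T,
  [/\ measurable C,
      forall w, (forall j, j \in S1 -> W j w (- (il.1%:Z)) <
                  Num.max (W (k, false) w (- (il.1%:Z))) (W (k, true) w (- (il.1%:Z)))) ->
        (forall j, j \in S2 -> W j w (h + il.2)%:Z <
            Num.max (W (k, false) w (h + il.2)%:Z) (W (k, true) w (h + il.2)%:Z)) -> C w &
      pr P C <= 64 * (2 - tau (h + il.1 + il.2)) / N + 1026 / N ^+ 2].
  apply: (@simultaneous_records _ _ _ _ _ _ iidW (k, false) (k, true) S1 S2 n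
    _ _ _ _ _ _ _ (tau (h + il.1 + il.2)) level) => //.
  - by rewrite xpair_eqE eqxx.
  - by apply: (Sk S1) => j /andP[].
  - by apply: (Sk S2) => j /andP[].
  - exact: (card_graph (fun=> false)).
  - exact: (card_graph (fun i => (i < k)%N)).
  - by move=> j; exact: (levelP j (k, false)).1.
  - by move=> j; exact: (levelP j (k, false)).1.
  - move=> j; have -> : (h + il.2)%:Z = - il.1%:Z + (h + il.1 + il.2)%:Z.
      by rewrite !PoszD; ring.
    exact: (levelP j (k, false)).2.
have {HC}/choice[C HC] := HC.
pose D := [set w | exists il, C il w].
have mD : measurable D.
  by apply: measurable_exists => il; case: (HC il).
have DP w : ~ D w -> (a w <-> a' w) \/ (b w <-> b' w).
  move=> nD; apply: contrapT => /not_orP[na nb]; apply: nD.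
  have [i /eqP Hi] : exists i : 'I_p, mixed_max 0 w (- i%:Z) <> swapped w (- i%:Z).
    apply: contrapT => /forallNP H; apply: na; split; apply: Ap => i ip;
      by have /contrapT := H (Ordinal ip).
  have [l /eqP Hl] : exists l : 'I_p,
      mixed_max k w (h + l)%:Z <> mixed_max k.+1 w (h + l)%:Z.
    apply: contrapT => /forallNP H; apply: nb; split; apply: Bp => l lp;
      by have /contrapT := H (Ordinal lp).
  exists (i, l); case: (HC (i, l)) => _ HCw _; apply: HCw.
    move=> [q c] /andP[/= qk /eqP ->].
    have := maxfam_change _ Hi qk; rewrite ltn0 /swap/= eqxx; apply.
    by move=> q' /negbTE q'k; rewrite ltn0 /swap/= q'k.
  move=> [q c] /andP[/= qk /eqP ->].
  have := maxfam_change _ Hl qk; rewrite ltnn ltnSn; apply.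
  by move=> q' q'k; rewrite ltnS [in RHS]leq_eqVlt (negbTE (q'k : q' != k :> nat)).
have Dle : pr P D <= \sum_(i < p) \sum_(l < p)
     (64 * (2 - tau (h + i + l)) / N + 1026 / N ^+ 2).
  rewrite pair_bigA/=.
  apply: (@le_trans _ _ (\sum_il pr P (C il))).
    rewrite -[leRHS]big_enum; apply: pr_cover => //.
      by move=> il; case: (HC il).
    by move=> w [il Cil]; exists il => //; rewrite mem_enum.
  by apply: ler_sum => il _; case: (HC il).
have ma : measurable a by exact: measurable_past.
have ma' : measurable a' by exact: measurable_past.
have mb : measurable b by exact: measurable_future.
have mb' : measurable b' by exact: measurable_future.
have h1 := pr_swap P ma ma' mb mb' mD DP.
have h2 : pr P (a `&` b') + pr P (a' `&` b) <=
    pr P (a `&` b) + pr P (a' `&` b') + pr P D.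
  by apply: pr_swap => // w /DP[?|[? ?]]; [left|right; split].
rewrite -e1 -e2 in h1 h2.
move: Dle; set S := \sum_(i < p) _ => Dle.
by rewrite ler_norml; apply/andP; split; lra.
Qed.

End one_swap.

Lemma swap_all :
  `|pr P (past_event (mixed_max 0) `&` future_event (mixed_max 0)) -
    pr P (past_event (mixed_max 0) `&` future_event (mixed_max n.+2))| <=
  \sum_(i < p) \sum_(l < p) (32 * (2 - tau (h + i + l)) + 513 / N).
Proof.
pose Q k := pr P (past_event (mixed_max 0) `&` future_event (mixed_max k)).
rewrite -/(Q 0) -/(Q n.+2) distrC -(telescope_sumr Q (leq0n _)) big_mkord.
apply: le_trans (ler_norm_sum _ _ _) _.
apply: (@le_trans _ _ (\sum_(k < n.+2) 2^-1 * \sum_(i < p) \sum_(l < p)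
     (64 * (2 - tau (h + i + l)) / N + 1026 / N ^+ 2))).
  by apply: ler_sum => k _; rewrite distrC; exact: one_swap.
rewrite sumr_const card_ord -[_ *+ n.+2]mulr_natl !mulr_sumr.
rewrite le_eqVlt; apply/orP; left; apply/eqP; apply: eq_bigr => i _.
rewrite !mulr_sumr; apply: eq_bigr => l _.
by field; rewrite gt_eqF// ltr_wpDr.
Qed.

End decoupling.

(** * From max-stability to a decoupled pair of maxima *)

(** Only max-infinite divisibility is kept: the affine normalization is applied
    to each of the copies, and commutes with the maximum as a_t > 0. *)
Lemma max_stable_iid (R : realType) (d : measure_display)
    (T : measurableType d) (P : probability T R) (X : int -> {RV P >-> R}) :
  max_stable X -> forall n, exists (d' : measure_display)
    (T' : measurableType d') (P' : probability T' R)
    (Z : 'I_n.+1 -> T' -> int -> R),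
    iid_paths P' Z /\
    forall A, product_borel A ->
      pr P' [set w | A (fun t => maxfam (fun i => Z i w t))] =
      pr P [set w | A (fun t => X t w)].
Proof.
move=> mX n; have [a [b [a0 [d' [T' [P' [Y [indY lawY lawmax]]]]]]]] := mX n.
pose norm (x : int -> R) t := (x t - b t) / a t.
have mnorm A : product_borel A -> product_borel (norm @^-1` A).
  apply: product_borel_preimage => t; rewrite /norm.
  apply: measurable_funM; last exact: measurable_cst.
  by apply: measurable_funB; [exact: measurable_coord|exact: measurable_cst].
exists d', T', P', (fun i w => norm (fun t => Y i t w)); split; last first.
  have e : (fun w (t : int) => maxfam (fun i => norm (fun t => Y i t w) t)) =
      (fun w t => (\big[Num.max/Y ord0 t w]_(i < n.+1) Y i t w - b t) / a t).
    apply/funext => w; apply/funext => t.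
    rewrite -/(maxfam (fun i => Y i t w)); apply/eqP; rewrite eq_le; apply/andP; split.
      apply/maxfam_leP => i; rewrite ler_pM2r ?invr_gt0//.
      by rewrite lerB//; move: i; apply/maxfam_leP.
    rewrite ler_pdivrMr// lerBlDr; apply/maxfam_leP => i.
    by rewrite -lerBlDr -ler_pdivrMr//; move: i; apply/maxfam_leP.
  by move=> A mA; have := lawmax A mA; rewrite -e => /(congr1 fine).
split.
- move=> i t; rewrite /norm; apply: measurable_funM => //.
  by apply: measurable_funB => //.
- move=> A mA; have := indY (fun i => norm @^-1` A i) (fun i => mnorm _ (mA i)).
  rewrite [X in _ = X](_ : _ = (\prod_(i < n.+1)
      pr P' [set w | A i (norm (fun t => Y i t w))])%:E); first by move/(congr1 fine).
  rewrite -prodEFin; apply: eq_bigr => i _; rewrite prE//.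
  by apply: (@measurable_path _ _ _ _ (fun w t => Y i t w)) => // t; exact: mnorm.
- move=> i j A mA; congr fine.
  by rewrite [LHS](lawY i _ (mnorm A mA)) [RHS](lawY j _ (mnorm A mA)).
Qed.

Lemma pr_setX (R : realType) (d : measure_display) (T : measurableType d)
    (P : probability T R) (A B : set T) : measurable A -> measurable B ->
  pr (P \x P)%E (A `*` B) = pr P A * pr P B.
Proof.
move=> mA mB; have := product_measure1E P P mA mB => /(congr1 fine).
by rewrite fineM ?fin_num_measure.
Qed.

Lemma pr_prod_marginal (R : realType) (d : measure_display)
    (T : measurableType d) (P : probability T R) (c : bool) (A : set T) :
  measurable A ->
  pr (P \x P)%E [set w | A (if c then w.2 else w.1)] = pr P A.
Proof.
move=> mA; case: c.
  rewrite [X in pr _ X = _](_ : _ = setT `*` A) ?pr_setX ?prT ?mul1r//.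
  by apply/seteqP; split => -[w1 w2] //= [].
rewrite [X in pr _ X = _](_ : _ = A `*` setT) ?pr_setX ?prT ?mulr1//.
by apply/seteqP; split => -[w1 w2] //= [].
Qed.

(** Two independent groups of independent series, on the product space. *)
Lemma iid_double (R : realType) (d : measure_display)
    (T : measurableType d) (P : probability T R) (J : finType)
    (Z : J -> T -> int -> R) :
  iid_paths P Z ->
  iid_paths (P \x P)%E (fun (j : J * bool) w => Z j.1 (if j.2 then w.2 else w.1)).
Proof.
move=> [mZ ind idt].
have mcoin c : measurable_fun setT (fun w : T * T => if c then w.2 else w.1).
  by case: c; [exact: measurable_snd|exact: measurable_fst].
have mZA i A : product_borel A -> measurable [set w | A (Z i w)].
  exact: (@measurable_path _ _ _ _ (Z i)).
have marg (i : J) (c : bool) A : product_borel A ->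
    pr (P \x P)%E [set w | A (Z i (if c then w.2 else w.1))] =
    pr P [set w | A (Z i w)].
  by move=> mA; exact: (pr_prod_marginal P c (mZA i A mA)).
split.
- move=> [i c] t; exact: (measurableT_comp (mZ i t) (mcoin c)).
- move=> A mA.
  have mF c : measurable [set w | forall i, A (i, c) (Z i w)].
    by apply: measurable_forall => i; exact: mZA.
  rewrite [X in pr _ X = _](_ : _ = [set w | forall i, A (i, false) (Z i w)] `*`
                             [set w | forall i, A (i, true) (Z i w)]); last first.
    apply/seteqP; split => -[w1 w2] /=.
      by move=> H; split => i; [have := H (i, false)|have := H (i, true)].
    by move=> [H1 H2] [i []].
  rewrite pr_setX//.
  rewrite (ind (fun i => A (i, false)))// (ind (fun i => A (i, true)))//.
  rewrite -big_split/=.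
  transitivity (\prod_i \prod_c pr (P \x P)%E
      [set w | A (i, c) (Z i (if c then w.2 else w.1))]); last first.
    by rewrite pair_bigA; apply: eq_bigr => -[].
  apply: eq_bigr => i _; rewrite big_bool/= mulrC.
  by congr (_ * _); apply/esym; [exact: (marg i true)|exact: (marg i false)].
- by move=> [i c] [i' c'] A mA; rewrite /= !marg//; exact: idt.
Qed.

Lemma root_expR (R : realType) (q v : R) n : 0 <= q ->
  q ^+ n.+1 = expR (- v) -> q = expR (- (v / n.+1%:R)).
Proof.
move=> q0 e; apply: (@pexpIrn _ n.+1) => //; rewrite ?nnegrE ?expR_ge0//.
rewrite e -expRM_natl; congr expR; field.
by rewrite gt_eqF// ltr_pwDl.
Qed.

(** * Mixing of events on a finite window *)

Section extremal_dependence.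
Context (R : realType) (d : measure_display) (T : measurableType d)
  (P : probability T R) (alpha : R) (X : int -> {RV P >-> R})
  (theta : int -> R).
Hypotheses (alpha0 : 0 < alpha) (stX : strictly_stationary X)
  (msX : max_stable X) (margX : frechet_margins alpha X)
  (extX : extremal_coefficient X theta).
Local Notation tau := (fun m : nat => theta m%:Z).

Let mX t : measurable_fun setT (X t).
Proof. exact: measurable_funPT. Qed.

Lemma pr_le_frechet t x : 0 < x ->
  pr P [set w | X t w <= x] = expR (- (x `^ (- alpha))).
Proof. by move=> x0; rewrite /pr margX /frechet_cdf x0. Qed.

Lemma pr_le2_extremal t (m : nat) x : 0 < x ->
  pr P [set w | X t w <= x /\ X (t + m%:Z) w <= x] =
  expR (- (theta m%:Z * x `^ (- alpha))).
Proof.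
move=> x0.
have -> : pr P [set w | X t w <= x /\ X (t + m%:Z) w <= x] =
    pr P [set w | X m%:Z w <= x /\ X 0 w <= x].
  congr fine; have := stX t (product_borel_le2 m%:Z 0 x).
  rewrite /preimage/= add0r => ->; congr (P _).
  by apply/seteqP; split => w [? ?]; split => //; rewrite addrC.
rewrite /pr extX// -/(pr P [set w | X 0 w <= x]) pr_le_frechet//= -expRM.
by congr expR; ring.
Qed.

Lemma frechet_level v : 0 < v -> exists2 x, 0 < x & x `^ (- alpha) = v.
Proof.
move=> v0; exists (v `^ (- alpha^-1)); first exact: powR_gt0.
by rewrite -powRrM mulrNN mulVf ?gt_eqF// powRr1// ltW.
Qed.

Lemma extremal_coefficient_ge0 m : 0 <= tau m.
Proof.
have [x x0 xE] := frechet_level (@ltr01 R).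
have h : pr P [set w | X 0 w <= x /\ X (0 + m%:Z) w <= x] <=
    pr P [set w | X 0 w <= x].
  have m1 t : measurable [set w | X t w <= x].
    exact: (measurable_path (phi := fun w t => X t w) mX (product_borel_le t x)).
  by apply: pr_le; [exact: (measurableI _ _ (m1 _) (m1 _))|exact: m1|move=> w []].
move: h; rewrite pr_le2_extremal// pr_le_frechet// xE mulr1 ler_expR lerN2.
by apply: le_trans.
Qed.

(** Independent copies whose maximum is X have, at the levels of X, the
    one- and two-dimensional margins of X raised to the power 1 / n. *)
Lemma copies_levels d' (T' : measurableType d') (P' : probability T' R) n
    (Z : 'I_n.+1 -> T' -> int -> R) :
  iid_paths P' Z ->
  (forall A, product_borel A ->
     pr P' [set w | A (fun t => maxfam (fun i => Z i w t))] =
     pr P [set w | A (fun t => X t w)]) ->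
  forall v, 0 < v -> exists x, forall j,
    (forall t, pr P' [set w | Z j w t <= x] = expR (- (v / n.+1%:R))) /\
    (forall t (m : nat), pr P' [set w | Z j w t <= x /\ Z j w (t + m%:Z) <= x] =
       expR (- (tau m * (v / n.+1%:R)))).
Proof.
move=> [mZ ind idt] lawX v v0; have [x x0 xE] := frechet_level v0.
exists x => j.
have root (A : set (int -> R)) q : product_borel A ->
    (forall w, A (fun t => maxfam (fun i => Z i w t)) <-> forall i, A (Z i w)) ->
    pr P [set w | A (fun t => X t w)] = expR (- q) ->
    pr P' [set w | A (Z j w)] = expR (- (q / n.+1%:R)).
  move=> mA maxA e; apply: root_expR; first exact: pr_ge0.
  rewrite -e -lawX//.
  rewrite [X in _ = pr _ X](_ : _ = [set w | forall i, A (Z i w)]); last first.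
    by apply/seteqP; split => w /= /maxA.
  rewrite (ind (fun=> A))// (eq_bigr (fun=> pr P' [set w | A (Z j w)])).
    by rewrite prodr_const card_ord.
  by move=> i _; exact: idt.
split=> [t|t m].
  apply: (root _ _ (product_borel_le t x)).
    by move=> w; split => [/maxfam_leP|H]; [|exact/maxfam_leP].
  by rewrite -xE; exact: pr_le_frechet.
rewrite mulrA; apply: (root _ _ (product_borel_le2 t (t + m%:Z) x)).
  move=> w; split => [[/maxfam_leP H1 /maxfam_leP H2] i|H].
    by split; [exact: H1|exact: H2].
  by split; apply/maxfam_leP => i; have [] := H i.
by rewrite -xE; exact: pr_le2_extremal.
Qed.

(** Max-stable vectors are positively associated. Here: a copy with margins
    expR (- 1 / n) and joint value expR (- tau m / n) must have a nonnegative
    joint tail, which for large n excludes tau m > 2. *)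
Lemma extremal_coefficient_le2 m : tau m <= 2.
Proof.
apply: joint_tail_ge0_le2; first exact: extremal_coefficient_ge0.
move=> n; have [d' [T' [P' [Z [iidZ lawZ]]]]] := max_stable_iid msX n.
have [x /(_ ord0)[x1 x2]] := copies_levels iidZ lawZ (@ltr01 R).
have mZ t : measurable [set w | Z ord0 w t <= x].
  apply: (measurable_path (phi := Z ord0) _ (product_borel_le t x)).
  by case: iidZ.
have := prUI P' (mZ 0) (mZ (0 + m%:Z)).
have := pr_le1 P' (measurableU _ _ (mZ 0) (mZ (0 + m%:Z))).
rewrite (_ : _ `&` _ = [set w | Z ord0 w 0 <= x /\ Z ord0 w (0 + m%:Z) <= x])//.
rewrite x2 !x1 mul1r.
lra.
Qed.

Section finite_window.
Variables (A B : set (nat -> R)) (p h : nat).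
Hypotheses (mA : product_borel A) (mB : product_borel B).
Hypotheses (Ap : depends_below p A) (Bp : depends_below p B).

Let E := [set w | A (fun k : nat => X (- k%:Z) w)].
Let F := [set w | B (fun k : nat => X (h + k)%:Z w)].

Lemma finite_window_mixing :
  `|pr P (E `&` F) - pr P E * pr P F| <=
  32 * \sum_(i < p) \sum_(l < p) (2 - tau (h + i + l)).
Proof.
apply: (@le_of_le_harmonic _ _ _ (\sum_(i < p) \sum_(l < p) 513)) => n.
have [d' [T' [P' [Z [iidZ lawZ]]]]] := max_stable_iid msX n.+1.
have iidW := iid_double iidZ.
set W := fun j : _ * bool => _ in iidW.
have levW : forall v, 0 < v -> exists x, forall j,
  (forall t, pr (P' \x P')%E [set w | W j w t <= x] = expR (- (v / n.+2%:R))) /\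
  (forall t (m : nat), pr (P' \x P')%E [set w | W j w t <= x /\
     W j w (t + m%:Z) <= x] = expR (- (tau m * (v / n.+2%:R)))).
  move=> v v0; have [x Hx] := copies_levels iidZ lawZ v0.
  exists x => -[i c].
  have mZ t : measurable [set w | Z i w t <= x].
    apply: (measurable_path (phi := Z i) _ (product_borel_le t x)).
    by case: iidZ.
  split=> [t|t m].
    by rewrite [LHS](pr_prod_marginal P' c (mZ t)); exact: (Hx i).1.
  rewrite [LHS](pr_prod_marginal P' c
    (A := [set w | Z i w t <= x /\ Z i w (t + m%:Z) <= x])).
    exact: (Hx i).2.
  exact: (measurableI _ _ (mZ _) (mZ _)).
(* At both ends the swapped maxima are functions of one or of both coordinates
   of the product space. *)
have := swap_all iidW extremal_coefficient_ge0 extremal_coefficient_le2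
  levW h mA mB Ap Bp.
pose C1 := [set w | A (fun k : nat => maxfam (fun i => Z i w (- k%:Z)))].
pose C2 := [set w | B (fun k : nat => maxfam (fun i => Z i w (h + k)%:Z))].
have mZm t : measurable_fun setT (fun w => maxfam (fun i => Z i w t)).
  by apply: measurable_maxfam => i; case: iidZ.
have mC1 : measurable C1.
  exact: (@measurable_path _ _ _ _
    (fun w (k : nat) => maxfam (fun i => Z i w (- k%:Z)))).
have mC2 : measurable C2.
  exact: (@measurable_path _ _ _ _
    (fun w (k : nat) => maxfam (fun i => Z i w (h + k)%:Z))).
have mA' : product_borel [set x : int -> R | A (fun k : nat => x (- k%:Z))].
  exact: (product_borel_reindex (fun k : nat => - k%:Z)).
have mB' : product_borel [set x : int -> R | B (fun k : nat => x (h + k)%:Z)].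
  exact: (product_borel_reindex (fun k : nat => (h + k)%:Z)).
rewrite [X in pr _ X - _](_ : _ = (C1 `&` C2) `*` setT); last first.
  apply/seteqP; split => -[w1 w2].
    by move=> [H1 H2]; split.
  by move=> [[H1 H2] _]; split.
rewrite [X in _ - pr _ X](_ : _ = C1 `*` C2); last first.
  have e w t : mixed_max W n.+2 w t = maxfam (fun i => Z i w.2 t).
    by rewrite /mixed_max /W/=; congr maxfam; apply/funext => i; rewrite ltn_ord.
  rewrite /future_event (_ : mixed_max W n.+2 = fun w t => maxfam (fun i => Z i w.2 t)).
    by apply/seteqP; split => -[w1 w2] [H1 H2]; split.
  by apply/funext => w; apply/funext => t.
rewrite !pr_setX//; last exact: measurableI.
rewrite prT mulr1.
have -> : pr P' C1 = pr P E by exact: (lawZ _ mA').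
have -> : pr P' C2 = pr P F by exact: (lawZ _ mB').
have -> : pr P' (C1 `&` C2) = pr P (E `&` F).
  by apply: (lawZ ([set x : int -> R | A (fun k : nat => x (- k%:Z))] `&`
    [set x : int -> R | B (fun k : nat => x (h + k)%:Z)])); rewrite product_borelE;
    exact: measurableI.
move/le_trans; apply; rewrite le_eqVlt; apply/orP; left; apply/eqP.
rewrite mulr_sumr mulr_suml -big_split/=; apply: eq_bigr => i _.
by rewrite mulr_sumr mulr_suml -big_split/=.
Qed.

End finite_window.

End extremal_dependence.

(** * Approximation by events of finitely many coordinates *)

Section approximation.
Context (R : realType) (d : measure_display) (T : measurableType d)
  (P : probability T R) (V : T -> nat -> R).
Hypothesis mV : forall k, measurable_fun setT (V^~ k).

(** Up to an event D of small probability, membership of the random path V in A is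
    decided by finitely many of its coordinates. *)
Definition finitely_approximable (A : set (nat -> R)) :=
  forall e, 0 < e -> exists (p : nat) (A' : set (nat -> R)) (D : set T),
    [/\ product_borel A', depends_below p A', measurable D, pr P D <= e &
        forall w, ~ D w -> A (V w) <-> A' (V w)].

Lemma depends_below_le (p q : nat) (A : set (nat -> R)) :
  (p <= q)%N -> depends_below p A -> depends_below q A.
Proof.
by move=> pq Ap x y xy; apply: Ap => i ip; apply: xy; exact: leq_trans pq.
Qed.

Let approximable_bigcup (F : nat -> set (nat -> R)) :
  (forall k, product_borel (F k)) -> (forall k, finitely_approximable (F k)) ->
  finitely_approximable (\bigcup_k F k).
Proof.
move=> mF apF e e0.
pose G k := [set w | F k (V w)].
have mG k : measurable (G k) by exact: (measurable_path mV (mF k)).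
pose H K := \big[setU/set0]_(k < K) G k.
have mH K : measurable (H K) by exact: bigsetU_measurable.
have mU : measurable (\bigcup_k G k) by exact: bigcupT_measurable.
have HU : \bigcup_K H K = \bigcup_k G k.
  apply/seteqP; split => w [k _].
    by rewrite /H -bigcup_mkord => -[i _ Gi]; exists i.
  by move=> Gk; exists k.+1 => //; rewrite /H -bigcup_mkord; exists k => /=.
have [K HK] : exists K, pr P (\bigcup_k G k) - pr P (H K) <= e / 2.
  have ndH : nondecreasing_seq H.
    move=> m n mn; apply/subsetPset; rewrite /H -!bigcup_mkord => w [i /= im Gi].
    by exists i => //=; exact: leq_trans mn.
  have := @nondecreasing_cvg_mu _ _ _ P H mH; rewrite HU => /(_ mU ndH).
  have -> : P \o H = EFin \o (pr P \o H).
    by apply/funext => k /=; rewrite prE.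
  rewrite [X in _ --> X](prE P mU) => /fine_cvgP[_].
  rewrite (_ : fine \o _ = pr P \o H); last by apply/funext.
  move/cvgrPdist_le => /(_ _ (divr_gt0 e0 (ltr0n _ 2)))[K _ /(_ K (leqnn K))] HK.
  by exists K; apply: le_trans HK; exact: ler_norm.
have e' : 0 < e / 2 / K.+1%:R by rewrite !divr_gt0.
have /choice[a Ha] := fun k => apF k _ e'.
have /choice[b Hb] := Ha.
have /choice[c Hc] := Hb.
exists (\max_(k < K) a k)%N, [set x | exists k : 'I_K, b k x],
  ([set w | exists k : 'I_K, c k w] `|` (\bigcup_k G k `\` H K)).
have mc : measurable [set w | exists k : 'I_K, c k w].
  by apply: measurable_exists => k; case: (Hc k).
have mD : measurable (\bigcup_k G k `\` H K) by exact: measurableD.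
split.
- rewrite product_borelE; apply: (@measurable_exists _ (path_space R nat)) => k.
  by case: (Hc k).
- move=> x y xy [k bk]; exists k; case: (Hc k) => _ dep _ _ _.
  apply: (dep x) => // i ik; apply: xy; apply: leq_trans ik _.
  exact: (leq_bigmax k).
- exact: measurableU.
- apply: le_trans (prU_le P mc mD) _.
  rewrite [leRHS](splitr e); apply: lerD.
    apply: (@le_trans _ _ (\sum_(k < K) pr P (c k))).
      rewrite -[leRHS]big_enum; apply: pr_cover => //.
        by move=> k; case: (Hc k).
      by move=> w [k ck]; exists k => //; rewrite mem_enum.
    apply: (@le_trans _ _ (\sum_(k < K) e / 2 / K.+1%:R)).
      by apply: ler_sum => k _; case: (Hc k).
    rewrite sumr_const card_ord -[_ *+ K]mulr_natr mulrAC ler_pdivrMr//.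
    by rewrite ler_wpM2l ?ler_nat// ltW// divr_gt0.
  apply: le_trans HK; rewrite lerBrDr.
  rewrite -(prUI P mD (mH K)) (_ : _ `&` _ = set0); last first.
    by apply/seteqP; split => // w [[]].
  rewrite {2}/pr measure0 addr0 (_ : _ `|` _ = \bigcup_k G k)//.
  rewrite setUC setDUK// -HU; exact: bigcup_sup.
- move=> w /not_orP[nc nD]; split.
    move=> [k _ Fk]; have GU : (\bigcup_k G k) w by exists k.
    have : H K w by apply: contrapT => nH; apply: nD.
    rewrite /H -bigcup_mkord => -[i /= iK Gi].
    exists (Ordinal iK); case: (Hc i) => _ _ _ _ /(_ w)[].
      by move=> ci; apply: nc; exists (Ordinal iK).
    by move=> FB _; exact: FB.
  move=> [k bk]; exists k => //; case: (Hc k) => _ _ _ _ /(_ w)[].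
    by move=> ck; apply: nc; exists k.
  by move=> _; apply.
Qed.

(** Approximability is preserved by the operations that generate the product
    sigma-algebra; for a countable union, a large finite part is enough. *)
Lemma product_borel_approximable A : product_borel A -> finitely_approximable A.
Proof.
suff: @product_borel R nat `<=` [set A | product_borel A /\ finitely_approximable A].
  by move=> H /H[].
apply: smallest_sub; first split.
- split; first by rewrite product_borelE; exact: measurable0.
  move=> e e0; exists 0%N, set0, set0; split => //.
  + by rewrite product_borelE; exact: measurable0.
  + by rewrite /pr measure0 ltW.
- move=> B [mB apB]; rewrite setTD; split.
    by rewrite product_borelE; exact: measurableC.
  move=> e /apB[p [B' [D [mB' dB' mD De BB']]]].
  exists p, (~` B'), D; split => //.
  + by rewrite product_borelE; exact: measurableC.
  + by move=> x y xy nBx By; apply/nBx/(dB' y) => // i ip; rewrite xy.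
  + by move=> w /BB' BBw; split => nB /BBw.
- move=> F HF; split.
    by rewrite product_borelE; apply: bigcupT_measurable => k; case: (HF k).
  by apply: approximable_bigcup => k; case: (HF k).
- move=> C HC; have mC : product_borel C by exact: sub_sigma_algebra.
  split=> // e e0; have [i [B [mB CE]]] := HC.
  exists i.+1, C, set0; split => //.
  + by rewrite CE => x y xy /=; rewrite xy.
  + by rewrite /pr measure0 ltW.
Qed.

End approximation.

(** * Summing the mixing coefficients *)

(** A rectangle of indices is contained in a triangle; on the right the terms are
    grouped by the value q of i + j. *)
Lemma antidiagonal_sum_ge (R : realType) (f : nat -> nat -> R) (m n : nat) :
  (forall i j, 0 <= f i j) ->
  \sum_(i < m) \sum_(j < n) f i j <=
  \sum_(q < m + n) \sum_(i < q.+1) f i (q - i)%N.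
Proof.
elim: m f => [|m IH] f f0.
  by rewrite big_ord0 sumr_ge0// => q _; exact: sumr_ge0.
rewrite big_ord_recl addSn.
under [leRHS]eq_bigr do rewrite big_ord_recl subn0.
rewrite big_split/=; apply: lerD.
  rewrite -(big_mkord xpredT (f 0)) -(big_mkord xpredT (f 0)).
  rewrite (big_cat_nat _ (leq_trans (leq_addl m n) (leqnSn _)))//=.
  by rewrite lerDl sumr_ge0.
rewrite big_ord_recl big_ord0 add0r.
by apply: le_trans (IH (fun i => f i.+1) _) _.
Qed.

Section mixing_sum.
Context (R : realType) (d : measure_display) (T : measurableType d)
  (P : probability T R) (alpha : R) (X : int -> {RV P >-> R})
  (theta : int -> R).
Hypotheses (alpha0 : 0 < alpha) (stX : strictly_stationary X)
  (msX : max_stable X) (margX : frechet_margins alpha X)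
  (extX : extremal_coefficient X theta).
Local Notation gap m := (2 - theta (Posz m)).

Let gap0 m : 0 <= gap m.
Proof. by rewrite subr_ge0; exact: (extremal_coefficient_le2 alpha0 stX msX). Qed.

Let past_future_le (A B : set (nat -> R)) (h : nat) e :
  product_borel A -> product_borel B -> 0 < e ->
  let E := [set w | A (fun k : nat => X (- k%:Z) w)] in
  let F := [set w | B (fun k : nat => X (h + k)%:Z w)] in
  exists p : nat, `|pr P (E `&` F) - pr P E * pr P F| <=
    32 * \sum_(i < p) \sum_(l < p) gap (h + i + l) + e.
Proof.
move=> mA mB e0 E F; pose V1 w (k : nat) := X (- k%:Z) w.
pose V2 w (k : nat) := X (h + k)%:Z w.
have mV1 k : measurable_fun setT (V1^~ k) by exact: measurable_funPT.
have mV2 k : measurable_fun setT (V2^~ k) by exact: measurable_funPT.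
have e4 : 0 < e / 4 by rewrite divr_gt0.
have [p1 [A' [D1 [mA' dA' mD1 D1e AA']]]] := product_borel_approximable P mV1 mA e4.
have [p2 [B' [D2 [mB' dB' mD2 D2e BB']]]] := product_borel_approximable P mV2 mB e4.
exists (maxn p1 p2).
have := finite_window_mixing alpha0 stX msX margX extX h mA' mB'
  (depends_below_le (leq_maxl p1 p2) dA') (depends_below_le (leq_maxr p1 p2) dB').
set E' := [set w | A' _]; set F' := [set w | B' _].
have mE : measurable E by exact: (measurable_path mV1).
have mE' : measurable E' by exact: (measurable_path mV1).
have mF : measurable F by exact: (measurable_path mV2).
have mF' : measurable F' by exact: (measurable_path mV2).
have hE : `|pr P E - pr P E'| <= e / 4.
  by apply: le_trans D1e; apply: pr_dist.
have hF : `|pr P F - pr P F'| <= e / 4.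
  by apply: le_trans D2e; apply: pr_dist.
have hEF : `|pr P (E `&` F) - pr P (E' `&` F')| <= e / 4 + e / 4.
  apply: le_trans (lerD D1e D2e); apply: le_trans (prU_le P mD1 mD2).
  apply: pr_dist; [exact: measurableI|exact: measurableI|exact: measurableU|].
  by move=> w /not_orP[/AA' h1 /BB' h2]; split=> -[x y]; split;
    [apply/h1|apply/h2|apply/h1|apply/h2].
have hprod : `|pr P E * pr P F - pr P E' * pr P F'| <= e / 4 + e / 4.
  have -> : pr P E * pr P F - pr P E' * pr P F' =
    (pr P E - pr P E') * pr P F + pr P E' * (pr P F - pr P F') by ring.
  apply: le_trans (ler_normD _ _) _; rewrite !normrM; apply: lerD.
    rewrite -[leRHS]mulr1; apply: ler_pM => //.
    by rewrite ger0_norm ?pr_ge0// pr_le1.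
  rewrite -[leRHS]mul1r; apply: ler_pM => //.
  by rewrite ger0_norm ?pr_ge0// pr_le1.
move: hEF hprod.
set s := \sum_(i < _) _; set x := pr P (E `&` F); set y := pr P (E' `&` F').
set x' := pr P E * _; set y' := pr P E' * _.
rewrite !ler_norml => /andP[? ?] /andP[? ?] /andP[? ?]; apply/andP; split; lra.
Qed.

Lemma alpha_mixing_ge0 h : (0 <= alpha_mixing X h)%E.
Proof.
apply: ereal_sup_ubound; exists set0, set0; split; last split.
- by rewrite product_borelE; exact: measurable0.
- by rewrite product_borelE; exact: measurable0.
- have e0 (g : T -> nat -> R) : [set w | set0 (g w)] = set0.
    by apply/seteqP; split.
  by rewrite /= (e0 (fun w k => X (- k%:Z) w)) set0I measure0 mul0e sube0 abse0.
Qed.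

Lemma alpha_mixing_le h :
  (alpha_mixing X h <=
   32%:E * \sum_(0 <= q <oo) (q.+1%:R * gap (h + q)%N)%:E)%E.
Proof.
apply: ge_ereal_sup => _ [A [B [mA [mB ->]]]].
set E := [set w | A _]; set F := [set w | B _].
have mE : measurable E.
  by apply: (measurable_path (phi := fun w (k : nat) => X (- k%:Z) w)) => // k;
    exact: measurable_funPT.
have mF : measurable F.
  by apply: (measurable_path (phi := fun w (k : nat) => X (h + k)%:Z w)) => // k;
    exact: measurable_funPT.
rewrite /= !prE//; last exact: measurableI.
apply/lee_addgt0Pr => e e0.
have [p Hp] := past_future_le h mA mB e0.
apply: le_trans (_ : (32 * (\sum_(i < p) \sum_(l < p) gap (h + i + l)) + e)%:E <= _)%E.
  by rewrite lee_fin.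
rewrite EFinD leeD2r// EFinM lee_pmul2l//.
apply: le_trans (nneseries_lim_ge (p + p) _); last first.
  by move=> q _ _; rewrite lee_fin mulr_ge0.
rewrite sumEFin lee_fin big_mkord.
have := @antidiagonal_sum_ge R (fun i l => gap (h + i + l)) p p
  (fun i l => gap0 (h + i + l)).
move/le_trans; apply; apply: ler_sum => q _.
rewrite (eq_bigr (fun=> gap (h + q)%N)).
  by rewrite sumr_const card_ord mulr_natl.
by move=> i _; rewrite -addnA subnKC// -ltnS.
Qed.

(** A second summation along antidiagonals: the gap at distance q + r occurs with
    weights 1, ..., q, of which each is at most q. *)
Lemma sum_alpha_mixing_le r :
  (\sum_(r.+1 <= h <oo) alpha_mixing X h <=
   32%:E * \sum_(1 <= h <oo) (h%:R ^+ 2 * gap (h + r)%N)%:E)%E.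
Proof.
apply: lime_le; first by apply: is_cvg_nneseries => n _ _; exact: alpha_mixing_ge0.
apply: nearW => m.
apply: le_trans (_ : \sum_(r.+1 <= h < m) 32%:E *
    \sum_(0 <= q <oo) (q.+1%:R * gap (h + q)%N)%:E <= _)%E.
  by apply: lee_sum => h _; exact: alpha_mixing_le.
have g0 h (q : nat) : (0 <= (q.+1%:R * gap (h + q)%N)%:E)%E.
  by rewrite lee_fin mulr_ge0.
rewrite -ge0_sume_distrr; last by move=> h _; apply: nneseries_ge0.
rewrite -nneseries_sum//; apply: lee_pmul => //.
  by apply: nneseries_ge0 => q _ _; apply: sume_ge0.
apply: lime_le; first by apply: is_cvg_nneseries => q _ _; apply: sume_ge0.
apply: nearW => n.
apply: le_trans (nneseries_lim_ge (m - r.+1 + n).+1 _); last first.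
  by move=> h _ _; rewrite lee_fin mulr_ge0// exprn_ge0.
under eq_bigr do rewrite sumEFin.
rewrite !sumEFin lee_fin exchange_big/= -{1}(add0n r.+1) big_addn.
rewrite big_add1/= !big_mkord.
under eq_bigr do rewrite big_mkord.
have := @antidiagonal_sum_ge R (fun i j => j.+1%:R * gap (i + r.+1 + j)%N)
  (m - r.+1) n (fun i j => mulr_ge0 (ler0n _ _) (gap0 _)).
move/le_trans; apply; apply: ler_sum => q _.
apply: (@le_trans _ _ (\sum_(i < q.+1) q.+1%:R * gap (q.+1 + r)%N)).
  apply: ler_sum => i _.
  have -> : (i + r.+1 + (q - i) = q.+1 + r)%N.
    by have := ltn_ord i; rewrite ltnS => iq; rewrite addnAC subnKC// addnS addSn.
  by rewrite ler_wpM2r// ler_nat ltnS leq_subr.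
by rewrite sumr_const card_ord -[(_ * _) *+ _]mulr_natl mulrA expr2.
Qed.

End mixing_sum.

(** * Upper limits *)

Section upper_limits.
Context (R : realType).
Implicit Types (u : nat -> \bar R) (l : \bar R).

Lemma limn_esup_le_near u l : (\forall n \near \oo, (u n <= l)%E) ->
  (limn_esup u <= l)%E.
Proof.
move=> ul; apply: (@le_trans _ _ (ereal_sup (u @` [set n | (u n <= l)%E]))).
  by apply: ereal_inf_lbound; exists [set n | (u n <= l)%E].
by apply: ge_ereal_sup => _ [n /= un <-].
Qed.

Lemma limn_esup_lt_near u l : (limn_esup u < l)%E ->
  \forall n \near \oo, (u n <= l)%E.
Proof.
move=> /ereal_inf_lt[_ [A nA <-] Al]; apply: filterS nA => n An.
by apply: le_trans (ltW Al); apply: ereal_sup_ubound; exists n.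
Qed.

Lemma limn_esup_ge0 u : (forall n, (0 <= u n)%E) -> (0 <= limn_esup u)%E.
Proof.
move=> u0; apply: le_ereal_inf_tmp => _ [A nA <-].
have [n An] := filter_ex nA.
by apply: le_trans (u0 n) _; apply: ereal_sup_ubound; exists n.
Qed.

Lemma cvg0_near u : (forall n, (0 <= u n)%E) ->
  (forall e : R, 0 < e -> \forall n \near \oo, (u n <= e%:E)%E) ->
  u @ \oo --> 0%E.
Proof.
move=> u0 H; apply: limn_esup_le_cvg => //.
apply/lee_addgt0Pr => e e0; rewrite add0e; apply: limn_esup_le_near; exact: H.
Qed.

Lemma near_cvg0 u : u @ \oo --> 0%E ->
  forall e : R, 0 < e -> \forall n \near \oo, (u n <= e%:E)%E.
Proof.
move=> /cvg_limn_einf_sup[_ e] eps eps0; apply: limn_esup_lt_near.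
by rewrite e lte_fin.
Qed.

End upper_limits.

(** * Exceedance probabilities *)

Section exceedance_bounds.
Context (R : realType) (d : measure_display) (T : measurableType d)
  (P : probability T R) (alpha : R) (X : int -> {RV P >-> R})
  (theta : int -> R).
Hypotheses (alpha0 : 0 < alpha) (stX : strictly_stationary X)
  (msX : max_stable X) (margX : frechet_margins alpha X)
  (extX : extremal_coefficient X theta).
Local Notation gap m := (2 - theta (Posz m)).

Let mle t x : measurable [set w | X t w <= x].
Proof.
exact: (measurable_path (phi := fun w t => X t w)
  (fun t => measurable_funPT (X t)) (product_borel_le t x)).
Qed.

Lemma exceedance_ge0 u : 0 <= exceedance X u.
Proof. exact: pr_ge0. Qed.

Lemma exceedanceE u : 0 < u -> exceedance X u = 1 - expR (- (u `^ (- alpha))).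
Proof.
move=> u0; rewrite -(pr_le_frechet margX 0 u0) -prC//; congr (fine (P _)).
by apply/seteqP; split => w /=; rewrite ltNge => /negP.
Qed.

Let level_small u : 1 <= u -> 0 < u `^ (- alpha) <= 1.
Proof.
move=> u1; rewrite powR_gt0 ?(lt_le_trans ltr01)//=.
by rewrite -(powRr0 u) ler_powR// oppr_le0 ltW.
Qed.

Lemma exceedance_ge u : 1 <= u -> u `^ (- alpha) / 2 <= exceedance X u.
Proof.
move=> u1; have /andP[v0 v1] := level_small u1.
rewrite exceedanceE ?(lt_le_trans ltr01)//.
by apply: sub1expRN_ge_half => //; exact: ltW.
Qed.

Lemma exceedance_gt0 u : 1 <= u -> 0 < exceedance X u.
Proof.
move=> u1; have /andP[v0 _] := level_small u1.
by apply: lt_le_trans (exceedance_ge u1); rewrite divr_gt0.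
Qed.

Lemma inv_exceedance_le u : 1 <= u -> (exceedance X u)^-1 <= 2 * u `^ alpha.
Proof.
move=> u1; have /andP[v0 _] := level_small u1.
have ua : 0 < u `^ alpha by rewrite powR_gt0// (lt_le_trans ltr01).
have e0 := exceedance_gt0 u1.
rewrite -[leRHS]invrK lef_pV2 ?posrE ?invr_gt0 ?mulr_gt0//.
by rewrite invfM mulrC -powRN; exact: exceedance_ge.
Qed.

Lemma cond_exceedance_ge0 h u : 0 <= cond_exceedance X h u.
Proof. by rewrite divr_ge0// ?exceedance_ge0// fine_ge0. Qed.

(** With v = u ^ (- alpha), the joint exceedance probability is
    1 - 2 expR (- v) + expR (- theta h v); its leading square is P(X_0 > u) ^ 2,
    and v <= 2 P(X_0 > u). *)
Lemma cond_exceedance_le h u : 1 <= u ->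
  cond_exceedance X h u <= exceedance X u + 2 * gap h.
Proof.
move=> u1; have u0 : 0 < u by exact: lt_le_trans ltr01 u1.
have /andP[v0 v1] := level_small u1.
have e0 := exceedance_gt0 u1.
have t0 := extremal_coefficient_ge0 alpha0 stX margX extX h.
have t2 := extremal_coefficient_le2 alpha0 stX msX margX extX h.
have -> : cond_exceedance X h u =
    (1 - 2 * expR (- (u `^ (- alpha))) +
     expR (- (theta h%:Z * u `^ (- alpha)))) / exceedance X u.
  congr (_ / _).
  rewrite -(pr_le2_extremal stX margX extX 0 h u0).
  have := prUI P (mle 0 u) (mle h%:Z u).
  rewrite !(pr_le_frechet margX)//.
  rewrite (_ : _ `&` _ = [set w | X 0 w <= u /\ X (0 + h%:Z) w <= u]); last first.
    by rewrite add0r.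
  have := prC P (measurableU _ _ (mle 0 u) (mle h%:Z u)).
  rewrite (_ : ~` _ = [set w | u < X h%:Z w /\ u < X 0 w]).
    by rewrite /pr; lra.
  apply/seteqP; split => w /=.
    by move=> /not_orP[/negP h1 /negP h2]; rewrite !ltNge.
  by rewrite !ltNge => -[/negP h1 /negP h2] [].
rewrite ler_pdivrMr//.
apply: le_trans (joint_tail_le_sqr (ltW v0) t0 t2) _.
rewrite -exceedanceE// [leRHS]mulrDl expr2 lerD2l [2 * _]mulrC -mulrA.
rewrite ler_wpM2l ?subr_ge0//.
by have := exceedance_ge u1; lra.
Qed.

End exceedance_bounds.

(** * Condition (M) *)

Theorem proposition5p1 (R : realType) (d : measure_display)
    (T : measurableType d) (P : probability T R)
    (alpha : R) (X : int -> {RV P >-> R}) (theta : int -> R) :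
  0 < alpha ->
  strictly_stationary X ->
  max_stable X ->
  frechet_margins alpha X ->
  extremal_coefficient X theta ->
  (forall h k : nat, (h <= k)%N -> theta h%:Z <= theta k%:Z) ->
  (exists (u : nat -> R) (r : nat -> nat),
     [/\ intermediate X u r,
         (fun n : nat => (u n `^ alpha)%:E *
            \sum_(1 <= h <oo)
               (h%:R ^+ 2 * (2 - theta (h + r n)%:Z))%:E)%E
           @ \oo --> 0%E &
         (fun k : nat => limn_esup (fun n : nat =>
            (\sum_(k <= h < (r n).+1) (2 - theta h%:Z))%:E))
           @ \oo --> 0%E]) ->
  condition_M X.
Proof.
move=> alpha0 stX msX margX extX mono [u [r [[u_oo r_oo ne_oo re_0] mix clus]]].
pose gap m : R := 2 - theta m%:Z.
pose e n := exceedance X (u n).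
have e0 n : 0 <= e n by exact: exceedance_ge0.
have gap0 m : 0 <= gap m.
  by rewrite subr_ge0; exact: (extremal_coefficient_le2 alpha0 stX msX margX).
have u_ge1 : \forall n \near \oo, 1 <= u n.
  by move/cvgryPge : u_oo; apply.
have r_ge k : \forall n \near \oo, (k <= r n)%N.
  by move/cvgnyPge : r_oo; apply.
(* Starting the sum of mixing coefficients at r n + 1 matches the first hypothesis,
   whose series starts with the gap 2 - theta (r n + 1). *)
exists u, (fun n => (r n).+1); split.
- split=> //.
  + by apply/cvgnyPge => k; near=> n; apply: leqW; near: n; exact: r_ge.
  + have re2_0 : (fun n => (r n)%:R * e n + (r n)%:R * e n) @ \oo --> (0 : R).
      by rewrite -[0](addr0 0); exact: cvgD.
    apply: (squeeze_cvgr _ _ re2_0); last exact: cvg_cst.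
    near=> n; apply/andP; split; first by apply: mulr_ge0; [exact: ler0n|exact: e0].
    rewrite -/(e n) -natr1 mulrDl mul1r lerD2l ler_peMl//.
    by rewrite ler1n; near: n; exact: r_ge.
- pose M n := ((u n `^ alpha)%:E *
    \sum_(1 <= h <oo) (h%:R ^+ 2 * gap (h + r n)%N)%:E)%E.
  have M0 : (fun n => 64%:E * M n)%E @ \oo --> 0%E.
    by rewrite -(mule0 64%:E); apply: cvgeZl.
  have mix0 n : (0 <= \sum_((r n).+1 <= h <oo) alpha_mixing X h)%E.
    by apply: nneseries_ge0 => h _ _; exact: alpha_mixing_ge0.
  apply: (squeeze_cvge _ _ M0); last exact: cvg_cst.
  near=> n; have u1 : 1 <= u n by near: n.
  have S0 : (0 <= \sum_(1 <= h <oo) (h%:R ^+ 2 * gap (h + r n)%N)%:E)%E.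
    by apply: nneseries_ge0 => h _ _; rewrite lee_fin mulr_ge0// exprn_ge0.
  apply/andP; split; first by rewrite mule_ge0// lee_fin invr_ge0; exact: e0.
  apply: (@le_trans _ _ ((2 * u n `^ alpha)%:E *
      (32%:E * \sum_(1 <= h <oo) (h%:R ^+ 2 * gap (h + r n)%N)%:E))%E).
    apply: lee_pmul => //; first by rewrite lee_fin invr_ge0; exact: e0.
      by rewrite lee_fin; exact: (inv_exceedance_le alpha0 margX).
    exact: (sum_alpha_mixing_le alpha0 stX msX margX extX).
  rewrite /M !muleA -!EFinM; have -> : 2 * u n `^ alpha * 32 = 64 * u n `^ alpha by ring.
  by [].
- pose b k n := \sum_(k <= h < (r n).+1) gap h.
  pose a k n := \sum_(k <= h < (r n).+2) cond_exceedance X h (u n).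
  apply: cvg0_near => [k|eps eps0].
    apply: limn_esup_ge0 => n; rewrite lee_fin; apply: sumr_ge0 => h _.
    exact: cond_exceedance_ge0.
  have eps8 : 0 < eps / 8 by rewrite divr_gt0.
  have := near_cvg0 clus (divr_gt0 eps8 (ltr0n _ 2)).
  apply: filterS => k clusk; apply: limn_esup_le_near.
  have : \forall n \near \oo, ((b k n)%:E <= (eps / 8)%:E)%E.
    apply: limn_esup_lt_near; apply: le_lt_trans clusk _.
    by rewrite lte_fin ltr_pdivrMr// ltr_pMr// ltr1n.
  have re_small : \forall n \near \oo, (r n)%:R * e n <= eps / 6.
    move/cvgrPdist_le : re_0 => /(_ _ (divr_gt0 eps0 (ltr0n _ 6))).
    apply: filterS => n; rewrite sub0r normrN; apply: le_trans; exact: ler_norm.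
  move=> b_small; near=> n.
  have u1 : 1 <= u n by near: n.
  have r1 : (1 <= r n)%N by near: n; exact: r_ge.
  have rk : (k <= r n)%N by near: n; exact: r_ge.
  have bn : b k n <= eps / 8 by rewrite -lee_fin; near: n.
  have en : (r n)%:R * e n <= eps / 6 by near: n.
  rewrite lee_fin.
  apply: (@le_trans _ _ (\sum_(k <= h < (r n).+2) (e n + 2 * gap h))).
    by apply: ler_sum => h _; exact: (cond_exceedance_le alpha0 stX msX margX extX).
  rewrite big_split/= -mulr_sumr sumr_const_nat.
  (* The clustering sum has one more term than in the hypothesis; by monotonicity
     of theta the last gap is dominated by the one before. *)
  have gap_last : gap (r n).+1 <= b k n.
    apply: (@le_trans _ _ (gap (r n))); first by rewrite lerD2l lerN2; exact: mono.
    by rewrite /b big_nat_recr//= lerDr sumr_ge0.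
  rewrite big_nat_recr ?(leq_trans rk)//= -/(b k n).
  have : e n *+ ((r n).+2 - k) <= 3 * ((r n)%:R * e n).
    rewrite -[e n *+ _]mulr_natl mulrA ler_wpM2r// -natrM ler_nat.
    by apply: leq_trans (leq_subr _ _) _; 
      rewrite -addn2 (mulnDl 1 2) mul1n leq_add2l leq_pmulr.
  lra.
Unshelve. all: by end_near.
Qed.
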